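(* Let $(\Pi_\infty,\rho)$ be a self-similar ultrametric Cantor set. Then the Hausdorff dimension of $(\Pi_\infty,\rho)$ is equal to the abscissa of convergence of its zeta-function $$\zeta(s)=\sum_{n=0}^\infty\ \sum_{\gamma\in\Pi_n}\operatorname{diam}_\rho([\gamma])^{s}.$$
   Context: Stationary Bratteli diagram: given finite sets $\mathcal{V}$, $\mathcal{E}$ and maps $s,r:\mathcal{E}\to\mathcal{V}$ (source, range), it is the infinite oriented graph with vertex levels $V_0=\{\circ\}$ (root) and $V_n$ a copy of $\mathcal{V}$ for $n\ge1$, and edge levels $E_0$, consisting of exactly one edge from $\circ$ to each vertex of $V_1$, and, for $n\ge 1$, $E_n$ a copy of $\mathcal{E}$, where $e\in\mathcal{E}$ goes from the copy of $s(e)$ in $V_n$ to the copy of $r(e)$ in $V_{n+1}$. Paths: $\Pi_n$ is the set of paths $\gamma=(e_0,\dots,e_{n-1})$ from the root to $V_n$ ($e_j\in E_j$, $r(e_j)=s(e_{j+1})$), of length $|\gamma|=n$ ($\Pi_0$ consists of the empty path); $\Pi=\bigcup_n\Pi_n$; $\Pi_\infty$ is the set of infinite paths, with the topology induced by the product of the discrete topologies on the $E_j$; $[\gamma]$ is the set of infinite paths with prefix $\gamma$. For $x\ne y$ in $\Pi_\infty$, $x\wedge y\in\Pi$ is the longest common prefix. Self-similar ultrametric Cantor set: such a $\Pi_\infty$ which is a Cantor set (nonempty, compact, totally disconnected, no isolated points), with an ultrametric $\rho$ of the form $\rho(x,y)=a_{x\wedge y}\,\alpha^{|x\wedge y|}$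 for $x\neq y$, $\rho(x,x)=0$, where $\alpha\in(0,1)$ (the parameter of $\rho$), $a_\gamma\in(0,\infty)$ for $\gamma\in\Pi$, $0<\inf_{\gamma\in\Pi}a_\gamma\le\sup_{\gamma\in\Pi}a_\gamma<\infty$, and the weight $w(\gamma)=a_\gamma\alpha^{|\gamma|}$ is non-increasing under extension of $\gamma$. By convention $\operatorname{diam}_\rho([\gamma])=w(\gamma)=a_\gamma\alpha^{|\gamma|}$. Abscissa of convergence: the real number $s_0>0$ such that the series $\zeta(s)$ defines a holomorphic function on the half-plane $\Re(s)>s_0$ which is singular at $s_0$ (it has no holomorphic extension to a neighbourhood of $s_0$); it exists for every self-similar ultrametric Cantor set. *)

(* Defs.v *)
From HB Require Import structures.
From mathcomp Require Import all_boot all_order all_algebra.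
From mathcomp Require Import complex.
From mathcomp Require Import all_classical all_reals all_analysis.

Set Implicit Arguments.
Unset Strict Implicit.
Unset Printing Implicit Defensive.

Import Order.TTheory GRing.Theory Num.Theory.
Import numFieldNormedType.Exports.

Local Open Scope classical_set_scope.
Local Open Scope ring_scope.

Record bratteli := Bratteli {
  bvertex : finType;
  bedge : finType;
  bsource : bedge -> bvertex;
  brange : bedge -> bvertex }.

Section paths.
Variable B : bratteli.

(* The edges of E_j.  The unique edge of E_0 that ends at v is v itself. *)
Definition edge (j : nat) : finType := if j is 0 then bvertex B else bedge B.

(* Sources and ranges live in [option (bvertex B)], with [None] the root; the
   level of a vertex is not recorded, since it is known from that of the edge. *)
Definition source (j : nat) : edge j -> option (bvertex B) :=
  match j with
  | 0 => fun=> None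
  | _.+1 => fun e => Some (@bsource B e)
  end.

Definition target (j : nat) : edge j -> option (bvertex B) :=
  match j with
  | 0 => fun v => Some v
  | _.+1 => fun e => Some (@brange B e)
  end.

Definition is_path n (g : {dffun forall j : 'I_n, edge j}) : bool :=
  [forall i : 'I_n, forall j : 'I_n,
     (j == i.+1 :> nat) ==> (target (g i) == source (g j))].

Definition fin_path (n : nat) : finType :=
  {g : {dffun forall j : 'I_n, edge j} | is_path g}.

Definition bpath := {n : nat & fin_path n}.

Definition path_length (g : bpath) : nat := tag g.

Definition is_prefix (g h : bpath) : Prop :=
  exists le_gh : (path_length g <= path_length h)%N,
    forall i, val (tagged g) i = val (tagged h) (widen_ord le_gh i).

Definition inf_path_set :
    set (prod_topology (fun j => discrete_topology (edge j))) :=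
  [set x | forall j, target (x j) = source (x j.+1)].

(* The canonical topology of [set_type] is the one induced by the inclusion. *)
Definition inf_path : topologicalType := set_type inf_path_set.

Definition edge_at (x : inf_path) (j : nat) : edge j := set_val x j.

Lemma truncation_is_path (x : inf_path) n :
  is_path (finfun (fun j : 'I_n => edge_at x j)).
Proof.
apply/forallP => i; apply/forallP => -[j ltjn]; apply/implyP => /= /eqP eji.
by subst j; rewrite !ffunE; apply/eqP; exact: (set_valP x).
Qed.

Definition truncation (x : inf_path) (n : nat) : bpath :=
  Tagged fin_path (Sub _ (truncation_is_path x n) : fin_path n).

(* The first level at which two distinct infinite paths differ. *)
Definition split_level (x y : inf_path) : nat :=
  xget 0%N [set n | edge_at x n <> edge_at y n /\
                    forall m, (m < n)%N -> edge_at x m = edge_at y m].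

Definition meet_path (x y : inf_path) : bpath := truncation x (split_level x y).

End paths.

Definition cantor_set (T : topologicalType) : Prop :=
  [/\ [set: T] !=set0, compact [set: T], totally_disconnected [set: T]
    & isolated [set: T] = set0].

Section metric.
Context {R : realType}.

Definition is_ultrametric (T : Type) (d : T -> T -> R) : Prop :=
  [/\ forall x y, 0 <= d x y,
      forall x y, d x y = 0 <-> x = y,
      forall x y, d x y = d y x
    & forall x y z, d x z <= Num.max (d x y) (d y z)].

Section hausdorff.
Context {T : Type}.
Variable d : T -> T -> R.
Local Open Scope ereal_scope.

Definition diameter (A : set T) : \bar R :=
  ereal_sup [set (d p.1 p.2)%:E | p in A `*` A].

(* Empty sets of a cover contribute 0 for every s, including s = 0; a nonempty
   set of diameter 0 contributes 0 `^ s, which is 1 for s = 0. *)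
Definition hausdorff_premeasure (s : R) (delta : R) (A : set T) : \bar R :=
  ereal_inf [set \sum_(0 <= i <oo | U i != set0) (diameter (U i) `^ s)
            | U in [set U : nat -> set T |
                     A `<=` \bigcup_i U i /\
                     forall i, diameter (U i) <= delta%:E]].

Definition hausdorff_measure (s : R) (A : set T) : \bar R :=
  ereal_sup [set hausdorff_premeasure s delta A
            | delta in [set delta : R | (0 < delta)%R]].

Definition hausdorff_dimension (A : set T) : \bar R :=
  ereal_inf [set s%:E
            | s in [set s : R | (0 <= s)%R /\ hausdorff_measure s A = 0]].

End hausdorff.

Variables (B : bratteli) (alpha : R) (a : bpath B -> R).

Definition weight (g : bpath B) : R := a g * alpha ^+ path_length g.

Definition self_similar_ultrametric
    (rho : inf_path B -> inf_path B -> R) : Prop :=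
  [/\ 0 < alpha < 1,
      [/\ forall g, 0 < a g,
          (0 < ereal_inf [set (a g)%:E | g in [set: bpath B]])%E
        & (ereal_sup [set (a g)%:E | g in [set: bpath B]] < +oo)%E],
      forall g h, is_prefix g h -> weight h <= weight g,
      is_ultrametric rho
    & (forall x, rho x x = 0) /\
      (forall x y, x <> y -> rho x y = weight (meet_path x y))].

(* diam [g] is by convention the weight of g, even when the cylinder [g] has
   fewer than two points. *)
Definition cylinder_diameter (g : bpath B) : R := weight g.

(* [R[i]] packed as a numClosedFieldType, so that it gets its topology and its
   normed module structure from the instances for abstract number fields. *)
Definition cplx : numClosedFieldType := R[i].

Definition re (z : cplx) : R := complex.Re z.
Definition im (z : cplx) : R := complex.Im z.
Definition of_real (x : R) : cplx := x%:C%C.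

(* x ^ z for x > 0, i.e. exp (z ln x). *)
Definition cpow (x : R) (z : cplx) : cplx :=
  of_real (expR (re z * ln x)) *
  (cos (im z * ln x) +i* sin (im z * ln x))%C.

Definition holomorphic_on (U : set cplx) (f : cplx -> cplx) : Prop :=
  forall z, U z -> derivable f z 1.

Definition zeta_term (z : cplx) (n : nat) : cplx :=
  \sum_(g : fin_path B n) cpow (cylinder_diameter (Tagged (@fin_path B) g)) z.

Definition series_sum (u : cplx -> nat -> cplx) (z : cplx) : cplx :=
  limn (series (u z)).

Definition singular_at (s0 : R) (f : cplx -> cplx) : Prop :=
  ~ exists (U : set cplx) (g : cplx -> cplx),
      [/\ open U, U (of_real s0), holomorphic_on U g
        & forall z, U z -> s0 < re z -> g z = f z].

Definition is_abscissa (u : cplx -> nat -> cplx) (s0 : R) : Prop :=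
  [/\ 0 < s0,
      forall z, s0 < re z -> cvgn (series (u z)),
      holomorphic_on [set z | s0 < re z] (series_sum u)
    & singular_at s0 (series_sum u)].

End metric.

(* Main.v *)
(* Let Q(n) be the number of walks with n edges in the finite graph.  Since Q is
   submultiplicative, Fekete's argument gives s0 such that Q(n) alpha^(n s0) >= 1
   for all n, while Q(n) alpha^(n s) is bounded for every s > s0; as no path is
   isolated, Q grows exponentially and s0 > 0.  The weights of the paths of length
   n are comparable to alpha^n.
   - For Re z > s0 the zeta series and its termwise derivative are dominated by a
     geometric series, so that the sum is holomorphic.  On the real axis its terms
     at s0 are bounded below, so the sum is unbounded as s decreases to s0, which
     no holomorphic extension around s0 could be.
   - Cylinders of level n cover the space and show that its dimension is at most s0.
     Conversely, if the s-dimensional measure vanishes, a cheap cover yields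
     finitely many walks of total cost sum alpha^(s |p|) <= 1 such that every long
     walk starts with one of them; splitting off such a prefix shows by induction
     that Q(n) alpha^(n s) is bounded, whence s >= s0. *)
Require Import Defs.
From mathcomp Require Import all_boot all_order all_algebra.
From mathcomp Require Import complex.
From mathcomp Require Import all_classical all_reals all_analysis.
From mathcomp Require Import ring lra.

Set Implicit Arguments.
Unset Strict Implicit.
Unset Printing Implicit Defensive.

Import Order.TTheory GRing.Theory Num.Theory.
Import numFieldNormedType.Exports.

(** * Walks in the finite graph and their number *)

Section Walks.
Variable B : bratteli.
Local Notation V := (bvertex B).
Local Notation E := (bedge B).
Implicit Types (v : V) (e : E) (p q : seq E).

Fixpoint walk v p : bool :=
  if p is e :: p' then (bsource e == v) && walk (brange e) p' else true.

Fixpoint walk_end v p : V := if p is e :: p' then walk_end (brange e) p' else v.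

Fixpoint walks n v : seq (seq E) :=
  if n is n'.+1 then
    [seq e :: p | e <- [seq e <- enum E | bsource e == v], p <- walks n' (brange e)]
  else [:: [::]].

Lemma sum_walksS n v (F : seq E -> nat) :
  \sum_(p <- walks n.+1 v) F p =
  \sum_(e | bsource e == v) \sum_(p <- walks n (brange e)) F (e :: p).
Proof. by rewrite /= big_allpairs_dep /= big_filter big_enum_cond. Qed.

Lemma sum_walksD m n v (F : seq E -> nat) :
  \sum_(p <- walks (m + n) v) F p =
  \sum_(p <- walks m v) \sum_(q <- walks n (walk_end v p)) F (p ++ q).
Proof.
elim: m v F => [|m IHm] v F; first by rewrite /= big_seq1.
rewrite addSn !sum_walksS; apply: eq_bigr => e _; exact: IHm.
Qed.

Lemma size_walksE n v : size (walks n v) = \sum_(p <- walks n v) 1.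
Proof. by rewrite sum1_size. Qed.

Definition nb_walks n := \sum_(v : V) size (walks n v).

Lemma size_walks_le n v : size (walks n v) <= nb_walks n.
Proof. by rewrite /nb_walks (bigD1 v) //= leq_addr. Qed.

(** Cut a walk after [m] edges: the rest is a walk from the vertex reached, so there are at most
    [nb_walks n] choices for it. *)
Lemma nb_walksD m n : nb_walks (m + n) <= nb_walks m * nb_walks n.
Proof.
rewrite {1 2}/nb_walks big_distrl /=; apply: leq_sum => v _.
rewrite !size_walksE sum_walksD big_distrl /=; apply: leq_sum => p _.
by rewrite mul1n -size_walksE size_walks_le.
Qed.

Lemma mem_walks n v p : (p \in walks n v) = (size p == n) && walk v p.
Proof.
elim: n v p => [|n IHn] v [|e p] //=.
  by apply/allpairsPdep => -[e [p []]].
rewrite eqSS andbCA -IHn; apply/allpairsPdep/andP.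
  by move=> [e' [p' []]]; rewrite mem_filter => /andP[? _] ? [-> ->].
by move=> [se pw]; exists e, p; rewrite mem_filter se mem_enum.
Qed.

Lemma walks_uniq n v : uniq (walks n v).
Proof.
elim: n v => //= n IHn v; apply: allpairs_uniq_dep => //.
- by rewrite filter_uniq ?enum_uniq.
- by move=> [e p] [e' p'] _ _ /= [-> ->].
Qed.

Lemma walk_cat v p q : walk v (p ++ q) = walk v p && walk (walk_end v p) q.
Proof. by elim: p v => //= e p IHp v; rewrite IHp andbA. Qed.

Lemma walk_end_cat v p q : walk_end v (p ++ q) = walk_end (walk_end v p) q.
Proof. by elim: p v => //=. Qed.

(** What follows the prefix [p] is a walk from the end of [p]. If [p] has more than [n] edges the
    left side is 0, so the truncated subtraction does no harm. *)
Lemma sum_prefix_walks n v p :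
  \sum_(q <- walks n v) (prefix p q : nat) <= size (walks (n - size p) (walk_end v p)).
Proof.
elim: n v p => [|n IHn] v [|e p].
- by rewrite /= big_seq1.
- by rewrite /= big_seq1.
- by rewrite subn0 size_walksE; apply: leq_sum => q _; rewrite leq_b1.
rewrite sum_walksS /= subSS; have [<-|nse] := eqVneq (bsource e) v; last first.
  rewrite big1 // => e' se'; rewrite big1 // => q _ /=.
  by have [ee'|//] := eqVneq e e'; rewrite ee' se' in nse.
rewrite (bigD1 e) //= [X in _ + X]big1 ?addn0 => [|e' /andP[_ nee']]; last first.
  by rewrite big1 // => q _; rewrite eq_sym (negbTE nee').
by under eq_bigr do rewrite eqxx; exact: IHn.
Qed.

(** Double counting of the pairs formed by a walk and an index whose word is a prefix of it. *)
Lemma walks_covered (I : finType) (pc : I -> seq E) (P : pred I) n v :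
    (forall q, size q = n -> walk v q -> exists2 i, P i & prefix (pc i) q) ->
  size (walks n v) <=
  \sum_(i | P i) size (walks (n - size (pc i)) (walk_end v (pc i))).
Proof.
move=> cov.
rewrite size_walksE; apply: (@leq_trans
  (\sum_(q <- walks n v) \sum_(i | P i) (prefix (pc i) q : nat))); last first.
  by rewrite exchange_big /=; apply: leq_sum => i _; apply: sum_prefix_walks.
rewrite big_seq_cond [leqRHS]big_seq_cond; apply: leq_sum => q.
rewrite andbT mem_walks => /andP[/eqP sq wq].
by have [i Pi pi] := cov q sq wq; rewrite (bigD1 i) //= pi leq_addr.
Qed.

Definition infinite_walk v (f : nat -> E) :=
  bsource (f 0) = v /\ forall j, brange (f j) = bsource (f j.+1).

Definition live v : bool := `[< exists f, infinite_walk v f >].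

Lemma walk_mkseq v f n :
  infinite_walk v f -> walk v (mkseq f n).
Proof.
elim: n v f => // n IHn v f [f0 fS].
rewrite /mkseq /= f0 eqxx (iotaDl 1 0) -map_comp; apply: IHn.
by split=> [|j]; rewrite ?fS.
Qed.

Lemma live_walk_end v f n :
  infinite_walk v f -> live (walk_end v (mkseq f n)).
Proof.
elim: n v f => [|n IHn] v f fw; first by apply/asboolP; exists f.
rewrite /mkseq /= (iotaDl 1 0) -map_comp; apply: IHn.
by case: fw => f0 fS; split=> [|j]; rewrite ?fS.
Qed.

(** Restricting to live ends makes the count nondecreasing in [n]; the number of all walks from [v]
    may drop because of dead ends. *)
Definition live_walks n v := \sum_(p <- walks n v) (live (walk_end v p) : nat).

Lemma live_walksD m n v :
  live_walks (m + n) v = \sum_(p <- walks m v) live_walks n (walk_end v p).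
Proof.
rewrite /live_walks sum_walksD; apply: eq_bigr => p _.
by apply: eq_bigr => q _; rewrite walk_end_cat.
Qed.

Lemma live_walks_le n v : live_walks n v <= size (walks n v).
Proof. by rewrite size_walksE; apply: leq_sum => p _; rewrite leq_b1. Qed.

Lemma live_walks_gt0 n v : live v -> 0 < live_walks n v.
Proof.
move=> /asboolP[f fw]; rewrite /live_walks (big_rem (mkseq f n)) /=.
  by rewrite live_walk_end.
by rewrite mem_walks size_mkseq eqxx walk_mkseq.
Qed.

Lemma live_walks_homo m n v : m <= n -> live_walks m v <= live_walks n v.
Proof.
move=> /subnKC <-; rewrite live_walksD; apply: leq_sum => p _.
by case: (boolP (live _)) => // /(live_walks_gt0 (n - m)).
Qed.

(** Each live vertex that is reached has at least two continuations by [m] edges to live ends, so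
    every block of [m] edges doubles the count. *)
Lemma live_walks_exp m k v :
  (forall w, live w -> 2 <= live_walks m w) -> live v ->
  2 ^ k <= live_walks (k * m) v.
Proof.
move=> m2 lv; elim: k => [|k IHk]; first exact: live_walks_gt0.
rewrite mulSn addnC live_walksD expnSr (leq_trans (leq_mul IHk (leqnn 2))) //.
rewrite big_distrl /=; apply: leq_sum => p _.
by case: (boolP (live _)) => // /m2; rewrite mul1n.
Qed.

Lemma live_walks2 v f g :
  infinite_walk v f -> infinite_walk v g -> f <> g ->
  exists m, 2 <= live_walks m v.
Proof.
move=> fw gw fg.
have [k fgk] : exists k, f k <> g k.
  by apply: contrapT => /forallNP h; apply/fg/funext => k; apply: contrapT (h k).
exists k.+1; rewrite /live_walks (big_rem (mkseq f k.+1)); last first.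
  by rewrite mem_walks size_mkseq eqxx walk_mkseq.
rewrite (big_rem (mkseq g k.+1)); last first.
  rewrite mem_rem_uniq ?walks_uniq // inE mem_walks size_mkseq eqxx walk_mkseq //= !andbT.
  apply/eqP => /(congr1 (fun s => nth (f 0) s k)); rewrite !nth_mkseq // => gf.
  exact: fgk.
by rewrite !live_walk_end.
Qed.

(** Two infinite walks from a live vertex separate after finitely many edges; a maximum over the
    finite vertex set, with [live_walks_homo], makes that number uniform. *)
Lemma nb_walks_exp :
    (exists v, live v) ->
    (forall v f, infinite_walk v f -> exists2 g, infinite_walk v g & f <> g) ->
  exists2 m, 0 < m & forall k, 2 ^ k <= nb_walks (k * m).
Proof.
move=> [v0 lv0] perf.
have /choice[m mP] v : exists m, live v -> 2 <= live_walks m v.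
  have [/asboolP[f fw]|_] := boolP (live v); last by exists 0.
  by have [g gw fg] := perf _ _ fw; have [m] := live_walks2 fw gw fg; exists m.
pose M := (\max_(v : V) m v).+1; exists M => // k.
apply: leq_trans (size_walks_le _ v0); apply: leq_trans (live_walks_le _ _).
apply: live_walks_exp => // w lw; apply: leq_trans (mP w lw) _.
by apply: live_walks_homo; rewrite ltnW // ltnS leq_bigmax.
Qed.

End Walks.

(** * König's lemma for words over a finite alphabet *)

Lemma konig (E : finType) (P : seq E -> Prop) :
    (forall p q, P (p ++ q) -> P p) ->
    (forall n, exists2 p, size p = n & P p) ->
  exists f : nat -> E, forall n, P (mkseq f n).
Proof.
(* The sequence is built through words that have extensions in [P] of every length. *)
move=> Pcat Pn; pose big p := forall n, exists2 q, size q = n & P (p ++ q).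
have bigS p : exists e, big p -> big (rcons p e).
  have [e0 _] : exists e : E, True.
    by have [[|e q] //] := Pn 1; exists e.
  apply: contrapT => /forallNP nb.
  have {}nb e : big p /\ exists n, forall q, size q = n -> ~ P (rcons p e ++ q).
    have /not_implyP[bp /existsNP[n nP]] := nb e; split=> //; exists n => q sq Pq.
    by apply: nP; exists q.
  have [bp _] := nb e0.
  have /choice[n nP] := fun e => (nb e).2.
  (* If each letter [e] failed at some length [n e], an extension long enough for all of these
     lengths would start with some [e], and cutting it would contradict the choice of [n e]. *)
  have [[|e q] //= [sq] Pq] := bp (\max_e n e).+1.
  apply: (nP e (take (n e) q)).
    by rewrite size_takel // sq leq_bigmax.
  by apply: (Pcat _ (drop (n e) q)); rewrite -catA cat_take_drop cat_rcons.
have [nx nxP] := choice bigS.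
pose pre := fix pre n := if n is n'.+1 then rcons (pre n') (nx (pre n')) else [::].
exists (fun n => nx (pre n)) => n.
have -> : mkseq (fun n => nx (pre n)) n = pre n.
  by elim: n => //= n IHn; rewrite mkseqS IHn.
suff /(_ 0)[q _] : big (pre n) by exact: Pcat.
by elim: n => [|n IHn] //=; exact: nxP.
Qed.

(** * Paths of the diagram as walks with a start vertex *)

Section InfinitePaths.
Variable B : bratteli.
Local Notation V := (bvertex B).
Local Notation E := (bedge B).

(** The edge of level 0 is its own end vertex, so an infinite path is a vertex together with an
    infinite walk from it. *)
Definition path_start (x : inf_path B) : V := edge_at x 0.
Definition path_edges (x : inf_path B) (j : nat) : E := edge_at x j.+1.

Lemma path_infinite_walk x : infinite_walk (path_start x) (path_edges x).
Proof.
have xP := set_valP x; split=> [|j]; first by have [] := xP 0.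
by have [] := xP j.+1.
Qed.

Lemma infinite_walk_path v f : infinite_walk v f ->
  exists2 x, path_start x = v & path_edges x = f.
Proof.
move=> [f0 fS].
pose y : prod_topology (fun j => discrete_topology (edge B j)) :=
  fun j => if j is j'.+1 return edge B j then f j' else v.
have yP : y \in @inf_path_set B.
  by rewrite inE => -[|j] /=; rewrite ?f0 ?fS.
by exists (SigSub yP).
Qed.

Lemma inf_path_ext (x y : inf_path B) :
  (forall j, edge_at x j = edge_at y j) -> x = y.
Proof. by move=> xy; apply/val_inj/functional_extensionality_dep. Qed.

(** The paths that share the first edge of [x] form an open set; if [x] were alone in it, [x] would
    be isolated. *)
Lemma no_isolated_path (x : inf_path B) :
  isolated [set: inf_path B] = set0 ->
  exists2 y, path_start y = path_start x & x <> y.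
Proof.
move=> iso0; apply: contrapT => noy.
suff : isolated [set: inf_path B] x by rewrite iso0.
split; first by rewrite inE.
exists [set y | path_start y = path_start x]%classic.
  have cont : continuous (fun y : inf_path B =>
      (proj 0 (set_val y)) : discrete_topology (edge B 0)).
    move=> y; apply: continuous_comp; first exact: initial_continuous.
    exact: proj_continuous.
  exact: cont (discrete_set1 (path_start x : discrete_topology (edge B 0))).
rewrite setIT; apply/seteqP; split=> [y yx|y -> //].
by apply: contrapT => nyx; apply: noy; exists y => // xy; apply: nyx.
Qed.

Lemma walkP (e0 : E) v p :
  walk v p <-> forall i, (i < size p)%N ->
    bsource (nth e0 p i) = (if i is i'.+1 then brange (nth e0 p i') else v).
Proof.
elim: p v => [|e p IHp] v //=; split.
  move=> /andP[/eqP ev /IHp wp] [|i] //= ip; rewrite wp //.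
  by case: i {ip}.
move=> h; rewrite (h 0) // eqxx; apply/IHp => i ip.
by have := h i.+1 ip; case: i {ip}.
Qed.

Definition dffun_walk n (g : {dffun forall j : 'I_n.+1, edge B j}) : V * seq E :=
  (g ord0, [seq g (lift ord0 i) | i : 'I_n]).

Lemma nth_dffun_walk (e0 : E) n g (i : 'I_n) :
  nth e0 (@dffun_walk n g).2 i = g (lift ord0 i).
Proof. by rewrite (nth_map i) ?size_enum_ord // nth_ord_enum. Qed.

Lemma is_path_walk (e0 : E) n g :
  is_path g = walk (@dffun_walk n g).1 (@dffun_walk n g).2.
Proof.
have nthE := nth_dffun_walk e0 g.
have sz : size (dffun_walk g).2 = n by rewrite size_map size_enum_ord.
apply/idP/idP => [gP|/(walkP e0) gP].
  apply/(walkP e0) => i; rewrite sz => ltin.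
  have {}gP (j k : 'I_n.+1) (jk : k = j.+1 :> nat) : target (g j) = source (g k).
    exact/eqP/(implyP (forallP (forallP gP j) k))/eqP.
  rewrite (nthE (Ordinal ltin)); case: i ltin => [|i] lin.
    by have [] := gP ord0 (lift ord0 (Ordinal lin)) erefl.
  rewrite (nthE (Ordinal (ltnW lin))).
  by have [] := gP (lift ord0 (Ordinal (ltnW lin))) (lift ord0 (Ordinal lin)) erefl.
apply/forallP => i; apply/forallP => j; apply/implyP.
have [j' ->|-> //] := unliftP ord0 j => ji0.
have {ji0} : j' = i :> nat by move: ji0; rewrite lift0 eqSS => /eqP.
have := gP j'; rewrite sz nthE => /(_ (ltn_ord _)).
have [i' ->|->] := unliftP ord0 i => /= + ji.
  by rewrite ji /= nthE => gij; apply/eqP; congr Some.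
by rewrite ji => gj; apply/eqP; congr Some.
Qed.

Lemma dffun_walk_inj n : injective (@dffun_walk n).
Proof.
move=> g h [g0 gS]; apply/ffunP => i.
have [j ->|->] := unliftP ord0 i; last exact: g0.
by move/eq_in_map : gS => /(_ j); rewrite mem_enum; apply.
Qed.

Lemma dffun_walk_surj (e0 : E) n v (p : seq E) : size p = n ->
  exists g, @dffun_walk n g = (v, p).
Proof.
move=> sp.
pose h (j : nat) : edge B j := if j is j'.+1 return edge B j then nth e0 p j' else v.
exists (finfun (fun j : 'I_n.+1 => h j)).
rewrite /dffun_walk ffunE; congr pair.
apply: (@eq_from_nth _ e0); first by rewrite size_map size_enum_ord.
move=> i; rewrite size_map size_enum_ord => lin.
have := nth_dffun_walk e0 (finfun (fun j : 'I_n.+1 => h j)) (Ordinal lin).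
by rewrite /= => ->; rewrite ffunE.
Qed.

(** [dffun_walk] matches the paths with the pairs of a vertex and a walk from it; the edge from the
    root accounts for the shift by one. *)
Lemma card_fin_path (e0 : E) n : #|fin_path B n.+1| = nb_walks B n.
Proof.
pose ws := [seq (v, p) | v <- enum V, p <- walks n v].
have -> : nb_walks B n = size ws.
  by rewrite size_allpairs_dep sumnE big_map big_enum.
rewrite -cardsT cardE -(size_map (fun g : fin_path B n.+1 => dffun_walk (val g))).
apply/perm_size/uniq_perm.
- rewrite map_inj_uniq ?enum_uniq //; apply: inj_comp val_inj.
  exact: dffun_walk_inj.
- apply: allpairs_uniq_dep; first exact: enum_uniq.
    by move=> v _; exact: walks_uniq.
  by move=> [v p] [w q] _ _ /= [-> ->].
move=> [v p]; apply/mapP/allpairsPdep => [[g _ vp]|[w [q [_ wq [-> ->]]]]].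
  exists v, p; split; rewrite ?mem_enum //.
  have := valP g; rewrite (is_path_walk e0) -vp mem_walks /= => ->; rewrite andbT.
  by move: vp => [_ ->]; rewrite size_map size_enum_ord.
move: wq; rewrite mem_walks => /andP[/eqP sq wq].
have [g gE] := dffun_walk_surj e0 w sq.
have gP : is_path g by rewrite (is_path_walk e0) gE.
by exists (Sub g gP); rewrite ?mem_enum ?inE.
Qed.

End InfinitePaths.

Local Open Scope classical_set_scope.
Local Open Scope ring_scope.

Lemma infinite_walk_mkseq (B : bratteli) (v : bvertex B) f :
  (forall n, walk v (mkseq f n)) -> infinite_walk v f.
Proof.
move=> fP; split=> [|j].
  by have /(walkP (f 0%N))/(_ 0%N isT) := fP 1%N.
have /(walkP (f 0%N))/(_ j.+1) := fP j.+2.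
by rewrite size_mkseq => /(_ (leqnn _)); rewrite !nth_mkseq.
Qed.

(** * From a cover by walks to a bound on their number *)

Section CoverGrowth.
(** In the application [i] numbers the sets of a countable cover, [J] marks the nonempty ones, and
    [st i], [pc i] describe a cylinder containing the [i]-th set. *)
Variables (B : bratteli) (J : pred nat).
Variables (st : nat -> bvertex B) (pc : nat -> seq (bedge B)).
Hypothesis cover : forall v f, infinite_walk v f ->
  exists i, [/\ J i, st i = v & pc i = mkseq f (size (pc i))].

(* Koenig's lemma is applied to all finite walks instead of using the compactness
   of the space of infinite paths: the zeta function also counts the walks that
   run into a dead end, and these have to be covered as well. *)
Lemma finite_subcover : exists M N, forall v p, size p = M -> walk v p ->
  exists i : 'I_N, [/\ J i, st i = v & prefix (pc i) p].
Proof.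
have /choice[M MP] v : exists M, forall p, size p = M -> walk v p ->
    exists i, [/\ J i, st i = v & prefix (pc i) p].
  apply: contrapT => /forallNP nM.
  (* If no length works for [v], there are uncovered walks of every length, and König's lemma turns
     them into an infinite walk that contradicts [cover]. *)
  pose P p := walk v p /\ forall i, J i -> st i = v -> ~ prefix (pc i) p.
  have Pcat p q : P (p ++ q) -> P p.
    rewrite /P walk_cat => -[/andP[wp _] np]; split=> // i Ji sti /prefixP[r pE].
    by apply: (np i) => //; rewrite pE -catA prefix_prefix.
  have Pn n : exists2 p, size p = n & P p.
    have /existsNP[p /not_implyP[sp /not_implyP[wp np]]] := nM n.
    by exists p => //; split=> // i Ji sti ip; apply: np; exists i.
  have [f fP] := konig Pcat Pn.
  have [i [Ji sti pcE]] := cover (infinite_walk_mkseq (fun n => (fP n).1)).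
  by apply: ((fP (size (pc i))).2 i) => //; rewrite -pcE prefix_refl.
pose M0 := (\max_v M v)%N; exists M0.
(* There are finitely many walks of [M0] edges, so one chosen index for each of them gives a finite
   range of indices. *)
have /choice[i_ iP] (vp : bvertex B * seq (bedge B)) : exists i,
    size vp.2 = M0 -> walk vp.1 vp.2 -> [/\ J i, st i = vp.1 & prefix (pc i) vp.2].
  have [[sp wp]|np] := pselect (size vp.2 = M0 /\ walk vp.1 vp.2); last first.
    by exists 0%N => sp wp; case: np.
  have Mv : (M vp.1 <= size vp.2)%N by rewrite sp leq_bigmax.
  move: wp; rewrite -{1}(cat_take_drop (M vp.1) vp.2) walk_cat => /andP[wp _].
  have [i [Ji sti ip]] := MP _ _ (size_takel Mv) wp; exists i => _ _; split=> //.
  by rewrite (prefix_trans ip) // prefix_take.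
exists (\max_v \max_(p <- walks M0 v) i_ (v, p)).+1%N => v p sp wp.
have [Ji sti ip] := iP (v, p) sp wp.
suff lti : (i_ (v, p) < (\max_v \max_(p <- walks M0 v) i_ (v, p)).+1)%N.
  by exists (Ordinal lti).
rewrite ltnS; apply: leq_trans (leq_bigmax v).
rewrite (big_rem p) ?leq_maxl //= mem_walks sp eqxx; exact: wp.
Qed.

(** Strong induction on [n] with one [K] for all start vertices: splitting off [pc i] costs the
    factor [t ^+ size (pc i)], and these factors sum to at most 1. *)
Lemma cover_growth (R : realFieldType) (t : R) :
    0 < t -> (forall i, J i -> 0 < size (pc i))%N ->
    (forall N, \sum_(i < N | J i) t ^+ size (pc i) <= 1) ->
  exists K, forall n, (nb_walks B n)%:R * t ^+ n <= K.
Proof.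
move=> t0 pc0 tpc; have [M [N MN]] := finite_subcover.
(* [K] takes care of the lengths [n < M], at which no prefix is guaranteed. *)
pose K := \sum_(n < M) (nb_walks B n)%:R * t ^+ n + 1.
have K0 : 0 <= K.
  by rewrite /K addr_ge0 // sumr_ge0 // => i _; rewrite mulr_ge0 ?exprn_ge0 ?(ltW t0).
have wK n (v : bvertex B) : (size (walks n v))%:R * t ^+ n <= K.
  elim/ltn_ind: n v => n IHn v.
  have [nM|Mn] := ltnP n M.
    apply: (@le_trans _ _ ((nb_walks B n)%:R * t ^+ n)).
      rewrite ler_wpM2r ?exprn_ge0 ?(ltW t0) // ler_nat. exact: size_walks_le.
    rewrite /K (bigD1 (Ordinal nM)) //= -addrA lerDl addr_ge0 // sumr_ge0 // => i _.
    by rewrite mulr_ge0 ?exprn_ge0 ?(ltW t0).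
  pose P (i : 'I_N) := [&& J i, st i == v & (size (pc i) <= n)%N].
  have wn : (size (walks n v) <=
      \sum_(i | P i) size (walks (n - size (pc i)) (walk_end v (pc i))))%N.
    apply: walks_covered => q sq wq.
    have st_q : size (take M q) = M by rewrite size_takel // sq.
    have wt : walk v (take M q).
      by move: wq; rewrite -{1}(cat_take_drop M q) walk_cat => /andP[].
    have [i [Ji sti ip]] := MN v _ st_q wt.
    have {}ip : prefix (pc i) q by rewrite (prefix_trans ip) // prefix_take.
    exists i => //; rewrite /P Ji sti eqxx /= -sq; exact: size_prefix.
  apply: (@le_trans _ _ (\sum_(i | P i) K * t ^+ size (pc i))).
    apply: (@le_trans _ _ (\sum_(i | P i)
      (size (walks (n - size (pc i)) (walk_end v (pc i))))%:R * t ^+ n)).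
      by rewrite -mulr_suml -natr_sum ler_wpM2r ?exprn_ge0 ?(ltW t0) // ler_nat.
    apply: ler_sum => i /and3P[Ji _ pin].
    rewrite -{2}(subnK pin) exprD mulrA ler_wpM2r ?exprn_ge0 ?(ltW t0) //.
    by apply: IHn; rewrite ltn_subrL (pc0 _ Ji) (leq_trans (pc0 _ Ji)).
  rewrite -mulr_sumr ler_piMr //; apply: le_trans (tpc N).
  rewrite big_mkcond [leRHS]big_mkcond; apply: ler_sum => i _; rewrite /P.
  by case: (J i) => //=; case: ifP => // _; rewrite exprn_ge0 ?(ltW t0).
exists (#|bvertex B|%:R * K) => n; rewrite /nb_walks natr_sum mulr_suml.
by rewrite -sum1_card natr_sum mulr_suml; apply: ler_sum => v _; rewrite mul1r.
Qed.

End CoverGrowth.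

(** * The exponential growth rate of a submultiplicative sequence *)

(* The witness is [s0 = inf_(m > 0) ln (Q m) / (m b)]. *)
Lemma growth_exponent (R : realType) (b : R) (Q : nat -> nat) :
    0 < b ->
    (forall m n, (Q (m + n) <= Q m * Q n)%N) ->
    (exists2 k, (0 < k)%N & forall j, (2 ^ j <= Q (j * k))%N) ->
  exists s0 : R, [/\ 0 < s0,
    forall n, 1 <= (Q n)%:R * expR (- (s0 * b * n%:R))
  & forall s : R, s0 < s -> exists K, forall n, (Q n)%:R * expR (- (s * b * n%:R)) <= K].
Proof.
move=> b0 QD [[//|k] _ Qexp].
have QM m n : (Q (m.+1 * n) <= Q n ^ m.+1)%N.
  elim: m => [|m IHm]; first by rewrite mul1n expn1.
  by rewrite mulSn expnS (leq_trans (QD _ _)) // leq_mul2l IHm orbT.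
(* If [Q n] were 0, then [Q (n * k.+1)] would vanish, although it is at least [2 ^ n]. *)
have Q0 n : 0 < (Q n)%:R :> R.
  rewrite ltr0n lt0n; apply/eqP => Qn0.
  have := leq_trans (Qexp n) (eq_leq (congr1 Q (mulnC _ _))).
  by move=> /leq_trans /(_ (QM k n)); rewrite Qn0 exp0n // leqNgt expn_gt0.
pose h m : R := ln (Q m)%:R / (m%:R * b).
have hdef m : (0 < m)%N -> ln (Q m)%:R = h m * b * m%:R.
  by move=> m0; rewrite /h; field; rewrite lt0r_neq0 //= pnatr_eq0 -lt0n m0.
have QE n s : (Q n)%:R * expR (- (s * b * n%:R)) = expR (ln (Q n)%:R - s * b * n%:R) :> R.
  by rewrite expRD lnK // posrE.
pose A := [set h m | m in [set m | (0 < m)%N]]%classic.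
(* Since [2 ^ m <= Q (m * k.+1) <= Q m ^ k.+1], every rate [h m] is at least [d], which makes the
   infimum positive. *)
pose d : R := ln 2 / (k.+1%:R * b).
have d0 : 0 < d by rewrite divr_gt0 ?mulr_gt0 // ln_gt0 // ltr1n.
have Ad : (lbound A d)%classic.
  move=> _ [m /= m0 <-]; rewrite /d /h ler_pdivrMr ?mulr_gt0 //.
  rewrite mulrAC ler_pdivlMr ?mulr_gt0 ?ltr0n //.
  suff : ln 2 * m%:R <= ln (Q m)%:R * k.+1%:R :> R.
    by move=> h2; rewrite [X in X <= _]mulrA [X in _ <= X]mulrA ler_wpM2r // ltW.
  rewrite !mulr_natr -!lnXn // -!natrX ler_ln ?posrE ?ltr0n ?expn_gt0 //; last first.
    by rewrite lt0n -(@pnatr_eq0 R) lt0r_neq0.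
  rewrite ler_nat (leq_trans (Qexp m)) // mulnC; exact: QM.
have A0 : (A !=set0)%classic by exists (h 1%N); exists 1%N.
have Alb : has_lbound A by exists d.
exists (inf A); split.
- by apply: (lt_le_trans d0); exact: lb_le_inf.
- move=> [|n]; first by rewrite mulr0 oppr0 expR0 mulr1 ler1n -(@ltr0n R).
  rewrite QE -[leLHS]expR0 ler_expR subr_ge0 (hdef n.+1) //.
  apply: ler_wpM2r; first exact: ler0n.
  apply: ler_wpM2r; first exact: ltW.
  by apply: ge_inf => //; exists n.+1.
(* Some rate [h m] is below [s], so a block of length [m] costs at most 1; removing blocks reduces
   every [n] to one below [m]. *)
move=> s As; have [_ [m /= m0 <-] hs] := inf_lt A0 As.
have s0 : 0 < s by apply: lt_trans As; apply: (lt_le_trans d0); exact: lb_le_inf.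
have Bm : (Q m)%:R * expR (- (s * b * m%:R)) <= 1.
  rewrite QE -[leRHS]expR0 ler_expR subr_le0 hdef //.
  apply: ler_wpM2r; first exact: ler0n.
  by apply: ler_wpM2r; exact: ltW.
exists (\sum_(r < m) (Q r)%:R) => n; elim/ltn_ind: n => n IHn.
have [nm|mn] := ltnP n m.
  apply: (@le_trans _ _ (Q n)%:R).
    rewrite ler_piMr ?(ltW (Q0 _)) // -[leRHS]expR0 ler_expR oppr_le0.
    by rewrite !mulr_ge0 // ltW.
  rewrite (bigD1 (Ordinal nm)) //= lerDl sumr_ge0 // => i _; exact/ltW.
have mnn : (n - m < n)%N by rewrite ltn_subrL m0 (leq_trans m0).
apply: le_trans (IHn _ mnn).
rewrite -{1 2}(subnKC mn) natrD mulrDr opprD expRD.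
apply: (@le_trans _ _ ((Q m * Q (n - m))%N%:R *
   (expR (- (s * b * m%:R)) * expR (- (s * b * (n - m)%:R))))).
  by rewrite ler_wpM2r ?mulr_ge0 ?expR_ge0 // ler_nat.
rewrite natrM mulrACA ler_piMl // mulr_ge0 ?expR_ge0 // ltW //.
Qed.

(** * Splitting of paths, real powers and extended real bounds *)

Definition agree (B : bratteli) n (x y : inf_path B) :=
  forall j, (j < n)%N -> edge_at x j = edge_at y j.

(** [xget] falls back on 0 unless its set is inhabited; for distinct paths the least level of
    disagreement lies in that set. *)
Lemma split_levelP (B : bratteli) (x y : inf_path B) : x <> y ->
  edge_at x (split_level x y) <> edge_at y (split_level x y) /\
  agree (split_level x y) x y.
Proof.
move=> xy; pose S := [set n | edge_at x n <> edge_at y n /\ agree n x y].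
suff : S (split_level x y) by [].
apply: xgetPex.
have exP : exists n, `[< edge_at x n <> edge_at y n >].
  apply: contrapT => /forallNP h; apply/xy/inf_path_ext => j.
  by apply: contrapT => nj; apply: (h j); exact/asboolP.
have [n /asboolP ndiff nmin] := ex_minnP exP; exists n; split=> // m mn.
apply: contrapT => mdiff; have /nmin : `[< edge_at x m <> edge_at y m >] by exact/asboolP.
by rewrite leqNgt mn.
Qed.

Lemma powRX (R : realType) (x s : R) n : 0 <= x -> (x ^+ n) `^ s = (x `^ s) ^+ n.
Proof. by move=> x0; rewrite -powR_mulrn // -powRrM mulrC powRrM powR_mulrn ?powR_ge0. Qed.

Lemma ereal_inf_gt0_lb (R : realType) T (f : T -> R) :
  (0 < ereal_inf [set (f t)%:E | t in [set: T]])%E ->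
  exists2 c, 0 < c & forall t, c <= f t.
Proof.
set l := ereal_inf _ => l0; have lf t : (l <= (f t)%:E)%E by apply: ereal_inf_lbound; exists t.
move: l l0 lf => [c|_|//]; first by rewrite lte_fin => c0 h; exists c.
(* The infimum is [+oo] only if [T] is empty, and then any constant serves. *)
by move=> h; exists 1 => // t; have := h t; rewrite leye_eq.
Qed.

Lemma ereal_sup_lty_ub (R : realType) T (f : T -> R) :
  (ereal_sup [set (f t)%:E | t in [set: T]] < +oo)%E ->
  exists C, forall t, f t <= C.
Proof.
set l := ereal_sup _ => l0.
have lf t : ((f t)%:E <= l)%E by apply: ereal_sup_ubound; exists t.
move: l l0 lf => [c _ h|//|_ h]; first by exists c.
by exists 1 => t; have := h t; rewrite leeNy_eq.
Qed.

(** * The Hausdorff dimension and the number of paths *)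

Section Dimension.
Variables (R : realType) (B : bratteli) (alpha : R).
Variables (a : bpath B -> R) (rho : inf_path B -> inf_path B -> R) (c : R).
Hypotheses (alpha0 : 0 < alpha) (alpha1 : alpha < 1).
Hypotheses (c0 : 0 < c) (ca : forall g, c <= a g).
Hypothesis rho_w : forall x y, x <> y -> rho x y = weight alpha a (meet_path x y).

Lemma rho_differ n x y : edge_at x n <> edge_at y n -> c * alpha ^+ n <= rho x y.
Proof.
move=> nxy; have xy : x <> y by move=> xy; apply: nxy; rewrite xy.
rewrite rho_w // /weight /= ler_pM ?exprn_ge0 ?(ltW alpha0) ?(ltW c0) //.
rewrite ler_wiXn2l ?(ltW alpha0) ?(ltW alpha1) //.
rewrite leqNgt; apply/negP => nsplit.
by apply: nxy; apply: (split_levelP xy).2.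
Qed.

(* When [U] is a singleton its diameter is 0 and the level must be taken large,
   which is why the error term [e] is needed. *)
Lemma cylinder_hull (U : set (inf_path B)) (s e : R) : U !=set0 -> 0 <= s -> 0 < e ->
  exists2 xn : inf_path B * nat, forall y, U y -> agree xn.2 y xn.1 &
    (((c * alpha ^+ xn.2) `^ s)%:E <= diameter rho U `^ s + e%:E)%E.
Proof.
move=> [x Ux] s0 e0.
pose P n := `[< exists y z, [/\ U y, U z & edge_at y n <> edge_at z n] >].
have [exP|nexP] := pselect (exists n, P n).
  (* With [n] the least level at which members of [U] differ, [U] lies in a cylinder of length [n],
     and two members differing there bound the diameter from below. *)
  have [n /asboolP[y [z [Uy Uz yz]]] nmin] := ex_minnP exP.
  exists (x, n) => /= [w Uw m mn|].
    apply: contrapT => wx; have /nmin : P m by apply/asboolP; exists w, x.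
    by rewrite leqNgt mn.
  apply: le_trans (leeDl _ _); last by rewrite lee_fin ltW.
  have cd : ((c * alpha ^+ n)%:E <= diameter rho U)%E.
    apply: (@le_trans _ _ (rho y z)%:E); first by rewrite lee_fin rho_differ.
    by apply: ereal_sup_ubound; exists (y, z).
  have can0 : (0 <= (c * alpha ^+ n)%:E)%E by rewrite lee_fin mulr_ge0 ?exprn_ge0 ?ltW.
  rewrite -poweR_EFin gt0_ler_poweR // in_itv /= ?leey ?andbT //.
  exact: le_trans cd.
have Ux1 y : U y -> forall n, edge_at y n = edge_at x n.
  by move=> Uy n; apply: contrapT => yx; apply: nexP; exists n; apply/asboolP; exists y, x.
(* Now [U] is a singleton. For [s = 0] both powers are 1, even that of the diameter 0, and level 0
   serves. *)
have [->|sn0] := eqVneq s 0.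
  exists (x, 0%N) => /=; first by move=> y _ j.
  by rewrite powRr0 poweRe0 leeDl // lee_fin ltW.
have {sn0} s0 : 0 < s by rewrite lt_neqAle eq_sym sn0.
have as1 : `|alpha `^ s| < 1.
  rewrite ger0_norm ?powR_ge0 // /powR gt_eqF // -[ltRHS]expR0 ltr_expR.
  by rewrite pmulr_rlt0 // ln_lt0 // alpha0.
have [n nP] : exists n, (c * alpha ^+ n) `^ s <= e.
  have e1 : 0 < (c `^ s)^-1 * e by rewrite mulr_gt0 ?invr_gt0 ?powR_gt0.
  have /cvgr0Pnorm_lt/(_ _ e1)[n _ /(_ n (leqnn n))] := cvg_expr as1.
  rewrite normrX ger0_norm ?powR_ge0 // => /= nP; exists n.
  rewrite powRM ?exprn_ge0 ?(ltW alpha0) ?(ltW c0) // -ler_pdivlMl ?powR_gt0 //.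
  by rewrite powRX ?(ltW alpha0) // ltW.
exists (x, n) => /=; first by move=> y Uy j _; exact: Ux1.
by apply: le_trans (leeDr _ (poweR_ge0 _ _)); rewrite lee_fin.
Qed.

Lemma dimension_lb (x0 : inf_path B) (s : R) : 0 <= s ->
    hausdorff_measure rho s [set: inf_path B] = 0%E ->
  exists K, forall n, (nb_walks B n)%:R * (alpha `^ s) ^+ n <= K.
Proof.
move=> s0 Hs0; pose t := alpha `^ s; have t0 : 0 < t by rewrite powR_gt0.
have cs0 : 0 < c `^ s by rewrite powR_gt0.
have ctE n : (c * alpha ^+ n) `^ s = c `^ s * t ^+ n.
  rewrite powRM ?exprn_ge0 ?(ltW alpha0) ?(ltW c0) //.
  by rewrite powRX // ltW.
(* Half of the budget [e + e] pays for the cover, the other half for the errors of [cylinder_hull];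
   the factors [t ^+ n_ i] then sum to less than [t]. *)
pose e : R := c `^ s * t / 2; have e0 : 0 < e by rewrite !mulr_gt0.
have : (hausdorff_premeasure rho s 1 [set: inf_path B] < e%:E)%E.
  apply: (@le_lt_trans _ _ 0%E); last by rewrite lte_fin.
  by rewrite -Hs0; apply: ereal_sup_ubound; exists 1 => //=.
move=> /ereal_inf_lt[_ [U [covU _] <-] sumU].
have /choice[xn xnP] i : exists xn : inf_path B * nat, U i !=set0 ->
    (forall y, U i y -> agree xn.2 y xn.1) /\
    (((c * alpha ^+ xn.2) `^ s)%:E <= diameter rho (U i) `^ s + (e / (2 ^ i.+1)%:R)%:E)%E.
  have [U0|U0] := pselect (U i !=set0).
    have ei0 : 0 < e / (2 ^ i.+1)%:R by rewrite divr_gt0 // ltr0n expn_gt0.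
    by have [x xP1 xP2] := cylinder_hull U0 s0 ei0; exists x.
  by exists (x0, 0%N) => /U0.
pose J i := U i != set0.
pose n_ i := (xn i).2.
have JP i : J i -> U i !=set0 by move=> Ji; exact/set0P.
have sumJ N : \sum_(i < N | J i) t ^+ n_ i < t.
  rewrite -(ltr_pM2l cs0) mulr_sumr -lte_fin -sumEFin.
  have -> : c `^ s * t = e + e by rewrite /e; field.
  rewrite EFinD; apply: (@le_lt_trans _ _
    (\sum_(0 <= i <oo | U i != set0) diameter rho (U i) `^ s + e%:E)%E); last first.
    by rewrite lteD2rE.
  apply: le_trans (epsilon_trick _ _ (ltW e0)); last by move=> i; exact: poweR_ge0.
  apply: (@le_trans _ _ (\sum_(0 <= i < N | U i != set0)
      (diameter rho (U i) `^ s + (e / (2 ^ i.+1)%:R)%:E))%E).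
    rewrite big_mkord; apply: lee_sum => i Ji; rewrite -ctE.
    exact: (xnP i (JP _ Ji)).2.
  apply: nneseries_lim_ge => i _ _; rewrite adde_ge0 ?poweR_ge0 // lee_fin.
  by rewrite divr_ge0 // ltW.
have t1 : t <= 1.
  by rewrite /t -(powRr0 alpha) ger_powR // alpha0 ltW.
(* As [t <= 1], a single cylinder of length 0 or 1 would already contribute at least [t]. So all
   lengths exceed 1 and each walk [pc i] is nonempty. *)
have n2 i : J i -> (1 < n_ i)%N.
  move=> Ji; rewrite ltnNge; apply/negP => ni1.
  have := sumJ i.+1; rewrite (bigD1 ord_max) //= ltNge => /negP; apply.
  rewrite -[leLHS]addr0 lerD ?sumr_ge0 // => [|j _]; last by rewrite exprn_ge0 ?ltW.
  by rewrite -[leLHS]expr1 ler_wiXn2l ?(ltW t0).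
pose st i := path_start (xn i).1.
pose pc i := mkseq (path_edges (xn i).1) (n_ i).-1.
apply: (@cover_growth B J st pc _ _ t t0).
- move=> v f /infinite_walk_path[x <- <-].
  have [i _ Uix] := covU x I; have U0 : U i !=set0 by exists x.
  exists i; have [ag _] := xnP i U0; have {ag} ag := ag _ Uix.
  have Ji : J i by exact/set0P.
  split=> //; first by rewrite /st /path_start ag // (ltn_trans _ (n2 _ Ji)).
  rewrite /pc size_mkseq; apply/eq_in_map => j; rewrite mem_iota add0n => jn.
  by rewrite /path_edges ag // -ltn_predRL.
- by move=> i Ji; rewrite size_mkseq ltn_predRL n2.
(* The walk lacks the edge from the root, that is one factor [t], so the bound [t] for the cylinders
   becomes 1 for the walks. *)
move=> N; rewrite -(ler_pM2r t0) mul1r mulr_suml; apply: le_trans (ltW (sumJ N)).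
apply: ler_sum => i Ji; rewrite size_mkseq -exprSr prednK //.
exact: ltn_trans (n2 _ Ji).
Qed.

Variable C : R.
Hypotheses (C0 : 0 < C) (aC : forall g, a g <= C).
Hypothesis rho_id : forall x, rho x x = 0.

Lemma rho_agree n x y : agree n x y -> rho x y <= C * alpha ^+ n.
Proof.
have [->|/eqP xy] := eqVneq x y.
  by rewrite rho_id => _; rewrite mulr_ge0 ?exprn_ge0 ?ltW.
move=> nxy; rewrite rho_w // /weight /= ler_pM ?exprn_ge0 ?(ltW alpha0) //.
  exact: le_trans (ltW c0) (ca _).
rewrite ler_wiXn2l ?(ltW alpha0) ?(ltW alpha1) // leqNgt; apply/negP => splitn.
by have [+ _] := split_levelP xy; apply; exact: nxy.
Qed.

(** The cylinders of length [n] cost together at most a constant times the [n]-th power of [alpha]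
    raised to [s - s1], which tends to 0. *)
Lemma dimension_ub (s s1 K : R) :
    0 < s1 -> s1 < s ->
    (forall n, #|fin_path B n|%:R * (alpha `^ s1) ^+ n <= K) ->
  hausdorff_measure rho s [set: inf_path B] = 0%E.
Proof.
move=> s10 s1s NK; have s0 : 0 < s by exact: lt_trans s1s.
have pre0 (d : R) : 0 < d -> hausdorff_premeasure rho s d [set: inf_path B] = 0%E.
  move=> d0; apply/eqP; rewrite eq_le; apply/andP; split; last first.
    apply: le_ereal_inf_tmp => _ [U _ <-]; apply: nneseries_ge0 => i _ _; exact: poweR_ge0.
  apply/lee_addgt0Pr => e e0; rewrite add0e.
  have as1 : `|alpha `^ (s - s1)| < 1.
    rewrite ger0_norm ?powR_ge0 // /powR gt_eqF // -[ltRHS]expR0 ltr_expR.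
    by rewrite pmulr_rlt0 ?subr_gt0 // ln_lt0 // alpha0.
  have a1 : `|alpha| < 1 by rewrite ger0_norm // ltW.
  have K0 : 0 <= K by rewrite (le_trans _ (NK 0%N)) // mulr_ge0.
  have e1 : 0 < (C `^ s * (K + 1))^-1 * e.
    by rewrite mulr_gt0 ?invr_gt0 ?mulr_gt0 ?powR_gt0 // ltr_wpDl.
  have d1 : 0 < C^-1 * d by rewrite mulr_gt0 ?invr_gt0.
  have /cvgr0Pnorm_lt/(_ _ e1)[n1 _ n1P] := cvg_expr as1.
  have /cvgr0Pnorm_lt/(_ _ d1)[n2 _ n2P] := cvg_expr a1.
  (* [n1] makes the total cost small, [n2] makes the diameters at most [d]. *)
  pose n := maxn n1 n2.
  have {n1P} /= := n1P n (leq_maxl _ _); rewrite ger0_norm ?exprn_ge0 ?powR_ge0 // => en.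
  have {n2P} /= := n2P n (leq_maxr _ _); rewrite ger0_norm ?exprn_ge0 ?(ltW alpha0) // => dn.
  pose ws := enum (fin_path B n).
  (* The cylinders are numbered by their position in [ws]; past its end [onth] returns [None] and
     the sets are empty. *)
  pose U i := [set x | onth ws i = Some (tagged (truncation x n))].
  have Uagree i x y : U i x -> U i y -> agree n x y.
    move=> Ux Uy j jn; have := etrans (esym Ux) Uy.
    move/(congr1 (omap (fun g : fin_path B n => val g (Ordinal jn)))).
    by rewrite /= !ffunE => -[].
  have diamU i : (diameter rho (U i) <= (C * alpha ^+ n)%:E)%E.
    apply: ge_ereal_sup => _ [[x y] [/= Ux Uy] <-]; rewrite lee_fin rho_agree //.
    exact: Uagree Ux Uy.
  have Can0 : 0 <= C * alpha ^+ n by rewrite mulr_ge0 ?exprn_ge0 ?ltW.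
  apply: (@le_trans _ _ (\sum_(0 <= i <oo | U i != set0) diameter rho (U i) `^ s)%E).
    apply: ereal_inf_lbound; exists U => //; split=> [x _|i].
      have /onthP[i ix] : tagged (truncation x n) \in ws by rewrite mem_enum.
      by exists i.
    rewrite (le_trans (diamU i)) // lee_fin; rewrite -ler_pdivlMl //; exact: ltW.
  have Ups i : U i !=set0 -> (diameter rho (U i) `^ s <= ((C * alpha ^+ n) `^ s)%:E)%E.
    move=> [x Ux]; rewrite -poweR_EFin.
    apply: gt0_ler_poweR; rewrite ?in_itv /= ?leey ?andbT ?lee_fin ?(ltW s0) //.
    by apply: ereal_sup_ubound; exists (x, x) => //=; rewrite rho_id.
  rewrite (nneseries_split_cond 0 (size ws)); last by move=> *; exact: poweR_ge0.
  rewrite eseries0 ?adde0; last first.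
    move=> i wsi /set0P[x]; rewrite /U /= onth_default //.
  apply: (@le_trans _ _ (\sum_(0 <= i < size ws) ((C * alpha ^+ n) `^ s)%:E)%E).
    rewrite add0n big_mkcond; apply: lee_sum => i _; case: ifPn => [/set0P|_]; first exact: Ups.
    by rewrite lee_fin powR_ge0.
  rewrite sumEFin lee_fin sumr_const_nat subn0 -cardE.
  rewrite powRM ?exprn_ge0 ?(ltW alpha0) ?(ltW C0) //.
  have -> : (alpha ^+ n) `^ s = (alpha `^ s1) ^+ n * (alpha `^ (s - s1)) ^+ n.
    rewrite -exprMn -powRD ?subrKC ?gt_eqF ?implybT //.
    exact/powRX/ltW.
  rewrite -mulr_natl [leLHS](_ : _ = C `^ s *
    (#|fin_path B n|%:R * (alpha `^ s1) ^+ n) * (alpha `^ (s - s1)) ^+ n); last by ring.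
  apply: (@le_trans _ _ (C `^ s * (K + 1) * (alpha `^ (s - s1)) ^+ n)); last first.
    by rewrite -ler_pdivlMl ?mulr_gt0 ?powR_gt0 ?ltr_wpDl // ltW.
  rewrite ler_wpM2r ?exprn_ge0 ?powR_ge0 // ler_wpM2l ?powR_ge0 //.
  by rewrite (le_trans (NK n)) // lerDl.
apply/eqP; rewrite eq_le; apply/andP; split.
  by apply: ge_ereal_sup => _ [d /= d0 <-]; rewrite pre0.
by apply: ereal_sup_ubound; exists 1 => /=; rewrite ?pre0.
Qed.

End Dimension.

(** * Elementary bounds for the exponential, sine and cosine *)

Section RealBounds.
Variable R : realType.
Implicit Types x y : R.

(** The inequality [1 + y <= expR y] at [x] and at [- x] gives [x <= expR x - 1 <= x * expR x]. *)
Lemma expR_sub1_le x : `|expR x - 1| <= `|x| * expR `|x|.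
Proof.
have e1 : 1 <= expR `|x| by rewrite -[leLHS]expR0 ler_expR.
have := expR_ge1Dx x; have := expR_ge1Dx (- x); rewrite expRN => hN hx.
have := ler_wpM2r (expR_ge0 x) hN; rewrite mulVf ?gt_eqF ?expR_gt0 // => h.
have xe : expR x <= expR `|x| by rewrite ler_expR ler_norm.
have nx0 := normr_ge0 x; have xx := ler_norm x.
have xN : - x <= `|x| by rewrite -normrN ler_norm.
have := expR_gt0 x.
rewrite ler_norml; nra.
Qed.

Lemma expR_sub1x_le x : `|expR x - 1 - x| <= x ^+ 2 * expR `|x|.
Proof.
have hx := expR_ge1Dx x; have := expR_ge1Dx (- x); rewrite expRN => hN.
have := ler_wpM2r (expR_ge0 x) hN; rewrite mulVf ?gt_eqF ?expR_gt0 // => h.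
rewrite ger0_norm; last by rewrite -addrA -opprD subr_ge0.
apply: (@le_trans _ _ (x * (expR x - 1))); first lra.
apply: le_trans (ler_norm _) _; rewrite normrM -real_normK ?num_real // expr2 -mulrA.
by rewrite ler_wpM2l // expR_sub1_le.
Qed.

Lemma MVT0_le (f df : R -> R) x M :
    (forall y, is_derive y 1 f (df y)) -> (forall y, 0 <= y <= x -> `|df y| <= M) ->
  0 <= x -> `|f x - f 0| <= M * x.
Proof.
move=> fd dM x0.
have cf : {within `[0, x], continuous f}.
  by apply: derivable_within_continuous => y _; exact: ex_derive.
have [y] := @MVT_segment _ f df 0 x x0 (fun y _ => fd y) cf.
rewrite in_itv /= => yx ->; rewrite subr0 normrM [`|x|]ger0_norm //.
by rewrite ler_wpM2r // dM.
Qed.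

Lemma norm_sin_le x : `|sin x| <= `|x|.
Proof.
wlog x0 : x / 0 <= x.
  move=> H; have [/H//|/ltW x0] := leP 0 x.
  by rewrite -[sin x]opprK -sinN !normrN -(normrN x); apply: H; rewrite oppr_ge0.
have := @MVT0_le sin cos x 1 (fun y => is_derive_sin y) (fun y _ => cos_max y) x0.
by rewrite sin0 subr0 mul1r [`|x|]ger0_norm.
Qed.

Lemma cos_sub1_le x : `|cos x - 1| <= x ^+ 2.
Proof.
wlog x0 : x / 0 <= x.
  move=> H; have [/H//|/ltW x0] := leP 0 x.
  by rewrite -cosN -sqrrN; apply: H; rewrite oppr_ge0.
have := @MVT0_le cos (fun y => - sin y) x x (fun y => is_derive_cos y).
rewrite cos0 expr2; apply=> // y /andP[y0 yx].
by rewrite normrN (le_trans (norm_sin_le _)) // ger0_norm.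
Qed.

Lemma sin_subx_le x : `|sin x - x| <= x ^+ 2.
Proof.
wlog x0 : x / 0 <= x.
  move=> H; have [/H//|/ltW x0] := leP 0 x.
  have := H (- x); rewrite oppr_ge0 sinN opprK sqrrN addrC distrC; exact.
have := @MVT0_le (fun y => sin y - y) (fun y => cos y - 1) x x.
rewrite sin0 subrr subr0 expr2; apply=> // y /andP[y0 yx].
have := @MVT0_le cos (fun y => - sin y) y 1 (fun y => is_derive_cos y).
rewrite cos0 mul1r => h; apply: le_trans yx; apply: h => // w _.
by rewrite normrN sin_max.
Qed.

End RealBounds.

(** * Norm and convergence in the complex numbers *)

Section Complex.
Variable R : realType.
Local Notation C := (@cplx R).
Implicit Types z w h : C.

(* The norm [`|z|] of [cplx] is itself an element of [cplx]. *)
Definition cnorm z : R := ComplexField.Normc.normc z.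

Lemma cnorm_lt z (e : R) : (`|z| < of_real e) = (cnorm z < e). Proof. exact: ltcR. Qed.
Lemma cnorm_ge0 z : 0 <= cnorm z. Proof. by case: z => x y; exact: sqrtr_ge0. Qed.
Lemma cnorm0 : cnorm 0 = 0. Proof. exact: ComplexField.Normc.normc0. Qed.
Lemma cnorm_gt0 z : z != 0 -> 0 < cnorm z.
Proof.
move=> z0; rewrite lt_neqAle cnorm_ge0 andbT eq_sym; apply: contra z0 => /eqP.
by move/ComplexField.Normc.eq0_normc => ->.
Qed.
Lemma cnormM z w : cnorm (z * w) = cnorm z * cnorm w. Proof. exact: ComplexField.Normc.normcM. Qed.
Lemma cnormV z : cnorm z^-1 = (cnorm z)^-1. Proof. exact: ComplexField.Normc.normcV. Qed.
Lemma cnormD z w : cnorm (z + w) <= cnorm z + cnorm w. Proof. exact: le_normcD. Qed.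
Lemma cnormN z : cnorm (- z) = cnorm z. Proof. exact: normcN. Qed.
Lemma cnorm_sum I (r : seq I) (P : pred I) (F : I -> C) :
  cnorm (\sum_(i <- r | P i) F i) <= \sum_(i <- r | P i) cnorm (F i).
Proof.
elim/big_ind2 : _ => [|x x' y y' xx yy|//]; first by rewrite cnorm0.
by rewrite (le_trans (cnormD _ _)) // lerD.
Qed.
Lemma re_le_cnorm z : `|re z| <= cnorm z.
Proof.
case: z => x y; rewrite /cnorm /= -sqrtr_sqr ler_wsqrtr // lerDl sqr_ge0 //.
Qed.
Lemma im_le_cnorm z : `|im z| <= cnorm z.
Proof.
case: z => x y; rewrite /cnorm /= -sqrtr_sqr ler_wsqrtr // lerDr sqr_ge0 //.
Qed.
Lemma cnorm_le_re_im z : cnorm z <= `|re z| + `|im z|.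
Proof.
case: z => x y; rewrite /cnorm /=.
rewrite -[leRHS]ger0_norm ?addr_ge0 // -sqrtr_sqr ler_wsqrtr //.
by rewrite sqrrD !real_normK ?num_real // addrAC lerDl mulrn_wge0 // mulr_ge0.
Qed.

Lemma reD z w : re (z + w) = re z + re w. Proof. by case: z; case: w. Qed.
Lemma imD z w : im (z + w) = im z + im w. Proof. by case: z; case: w. Qed.
Lemma reN z : re (- z) = - re z. Proof. by case: z. Qed.
Lemma imN z : im (- z) = - im z. Proof. by case: z. Qed.
Lemma re_sum I (r : seq I) (P : pred I) (F : I -> C) :
  re (\sum_(i <- r | P i) F i) = \sum_(i <- r | P i) re (F i).
Proof. by elim/big_rec2 : _ => // i x y _ <-; rewrite reD. Qed.
Lemma im_sum I (r : seq I) (P : pred I) (F : I -> C) :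
  im (\sum_(i <- r | P i) F i) = \sum_(i <- r | P i) im (F i).
Proof. by elim/big_rec2 : _ => // i x y _ <-; rewrite imD. Qed.

Lemma gt0_of_real z : 0 < z -> exists2 e : R, 0 < e & z = of_real e.
Proof. by case: z => x y; rewrite ltcE /= => /andP[/eqP -> x0]; exists x. Qed.

(** Only positive reals are positive in [cplx], so real radii suffice. *)
Lemma cvg_cnormP T (F : set_system T) {FF : Filter F} (f : T -> C) (l : C) :
  f @ F --> l <-> forall e : R, 0 < e -> \forall t \near F, cnorm (l - f t) < e.
Proof.
split=> [/cvgrPdist_lt fl e e0|fl].
  have e0' : 0 < of_real e :> C by rewrite ltcR.
  by apply: filterS (fl _ e0') => t; rewrite cnorm_lt.
apply/cvgrPdist_lt => _ /gt0_of_real[e e0 ->].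
by apply: filterS (fl _ e0) => t; rewrite cnorm_lt.
Qed.

Lemma cvg_re_im (u : nat -> C) (x y : R) :
  (fun n => re (u n)) @ \oo --> x -> (fun n => im (u n)) @ \oo --> y ->
  u @ \oo --> (Complex x y : C).
Proof.
move=> /cvgrPdist_lt ux /cvgrPdist_lt uy; apply/cvg_cnormP => e e0.
have e20 : 0 < e / 2 by rewrite divr_gt0.
near=> n; apply: le_lt_trans (cnorm_le_re_im _) _.
rewrite reD imD reN imN [ltRHS]splitr ltrD //; near: n; [exact: ux|exact: uy].
Unshelve. all: by end_near. Qed.

Lemma cvg_re (u : nat -> C) (l : C) :
  u @ \oo --> l -> (fun n => re (u n)) @ \oo --> re l.
Proof.
move=> /cvg_cnormP ul; apply/cvgrPdist_lt => e e0; apply: filterS (ul _ e0) => n.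
by apply: le_lt_trans; rewrite -reN -reD re_le_cnorm.
Qed.

(** Real and imaginary parts converge absolutely; the limit inherits the bound from the partial
    sums. *)
Lemma series_cvg_dominated (u : nat -> C) (M : nat -> R) :
    (forall n, cnorm (u n) <= M n) -> cvgn (series M) ->
  cvgn (series u) /\ cnorm (limn (series u)) <= limn (series M).
Proof.
move=> uM cM; have M0 n : 0 <= M n := le_trans (cnorm_ge0 _) (uM n).
have cvgR (v : nat -> R) : (forall n, `|v n| <= M n) -> cvgn (series v).
  by move=> vM; apply: (@normed_cvg R R v); apply: (series_le_cvg _ M0 vM cM) => n /=.
have cu : cvgn (series u).
  apply/cvg_ex; exists (Complex (limn (series (fun n => re (u n))))
                                (limn (series (fun n => im (u n))))).
  apply: cvg_re_im.
    under eq_cvg do rewrite re_sum.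
    by apply: cvgR => n; exact: le_trans (re_le_cnorm _) (uM n).
  under eq_cvg do rewrite im_sum.
  by apply: cvgR => n; exact: le_trans (im_le_cnorm _) (uM n).
split=> //; apply/ler_addgt0Pr => e e0.
have /cvg_cnormP/(_ _ e0)[n _ /(_ n (leqnn n))/= ne] := cu.
rewrite -[limn (series u)](subrK (series u n)) (le_trans (cnormD _ _)) // addrC.
rewrite lerD ?(ltW ne) //.
apply: (@le_trans _ _ (series M n)).
  by rewrite (le_trans (cnorm_sum _ _ _)) // ler_sum.
apply: nondecreasing_cvgn_le => // m k mk.
by rewrite -subr_ge0 sub_series_geq // sumr_ge0.
Qed.

End Complex.

(** * Complex powers and termwise differentiation *)

Section ComplexPower.
Variable R : realType.
Local Notation C := (@cplx R).
Implicit Types z w h : C.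

Lemma cpowD (x : R) z w : cpow x (z + w) = cpow x z * cpow x w.
Proof.
case: z => a b; case: w => c d; rewrite /cpow /of_real /re /im /=.
rewrite !mulrDl expRD sinD cosD; apply/eqP; rewrite eq_complex /=.
by apply/andP; split; apply/eqP; ring.
Qed.

Lemma cnorm_cpow (x : R) z : cnorm (cpow x z) = expR (re z * ln x).
Proof.
rewrite /cpow cnormM /cnorm /of_real /= expr0n addr0 cos2Dsin2 sqrtr1 mulr1.
by rewrite sqrtr_sqr ger0_norm ?expR_ge0.
Qed.

(** The real and the imaginary part of the remainder split into two terms each; all four are at most
    [r ^+ 2 * expR r], whence the factor 4. *)
Lemma cpow_taylor (x : R) h :
  cnorm (cpow x h - 1 - h * of_real (ln x)) <=
    4 * (cnorm h * ln x) ^+ 2 * expR (cnorm h * `|ln x|).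
Proof.
set L := ln x; set r := cnorm h * `|L|.
have r0 : 0 <= r by rewrite mulr_ge0 ?cnorm_ge0.
have -> : (cnorm h * L) ^+ 2 = r ^+ 2 by rewrite /r !exprMn real_normK ?num_real.
have aL : `|re h * L| <= r by rewrite normrM ler_wpM2r // re_le_cnorm.
have bL : `|im h * L| <= r by rewrite normrM ler_wpM2r // im_le_cnorm.
apply: le_trans (cnorm_le_re_im _) _.
have -> : re (cpow x h - 1 - h * of_real L) =
    (expR (re h * L) - 1 - re h * L) + expR (re h * L) * (cos (im h * L) - 1).
  by case: h {r r0 aL bL} => p q; rewrite /cpow /of_real /re /im /=; ring.
have -> : im (cpow x h - 1 - h * of_real L) =
    (expR (re h * L) - 1) * sin (im h * L) + (sin (im h * L) - im h * L).
  by case: h {r r0 aL bL} => p q; rewrite /cpow /of_real /re /im /=; ring.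
move: (re h * L) (im h * L) aL bL => p q pr qr.
have e0 := expR_gt0 r; have r2 : 0 <= r ^+ 2 by rewrite sqr_ge0.
have sq y : `|y| <= r -> y ^+ 2 <= r ^+ 2.
  by move=> yr; rewrite -(real_normK (num_real y)) lerXn2r ?nnegrE.
have ep : expR `|p| <= expR r by rewrite ler_expR.
have h1 : `|expR p - 1 - p| <= r ^+ 2 * expR r.
  by apply: le_trans (expR_sub1x_le p) _; rewrite ler_pM ?sqr_ge0 ?expR_ge0 ?sq.
have h2 : `|expR p * (cos q - 1)| <= r ^+ 2 * expR r.
  rewrite normrM mulrC ler_pM // ?(le_trans (cos_sub1_le _)) ?sq //.
  by rewrite ger0_norm ?expR_ge0 // ler_expR (le_trans (ler_norm _)).
have h3 : `|(expR p - 1) * sin q| <= r ^+ 2 * expR r.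
  rewrite normrM [leRHS](_ : _ = (r * expR r) * r); last by ring.
  rewrite ler_pM // ?(le_trans (norm_sin_le _)) // (le_trans (expR_sub1_le _)) //.
  by rewrite ler_pM ?expR_ge0.
have h4 : `|sin q - q| <= r ^+ 2 * expR r.
  rewrite (le_trans (sin_subx_le _)) // (le_trans (sq _ qr)) // ler_peMr //.
  by rewrite -[leLHS]expR0 ler_expR.
have := ler_normD (expR p - 1 - p) (expR p * (cos q - 1)).
have := ler_normD ((expR p - 1) * sin q) (sin q - q).
lra.
Qed.

Lemma cpow_of_real (x t : R) : cpow x (of_real t) = of_real (expR (t * ln x)).
Proof.
rewrite /cpow /of_real /re /im /= mul0r cos0 sin0; apply/eqP.
by rewrite eq_complex /=; apply/andP; split; apply/eqP; ring.
Qed.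

(** The quadratic bounds on the remainders add up, so the sum has derivative [limn (series u')] at
    [z]. *)
Lemma derivable_series_sum (u : C -> nat -> C) (u' : nat -> C) z (M : nat -> R) (d : R) :
    0 < d -> cvgn (series M) ->
    (forall n, cnorm (u z n) <= M n) -> (forall n, cnorm (u' n) <= M n) ->
    (forall h, cnorm h < d ->
       forall n, cnorm (u (z + h) n - u z n - h * u' n) <= cnorm h ^+ 2 * M n) ->
  derivable (series_sum u) z 1.
Proof.
move=> d0 cM uM u'M tM.
have [cu _] := series_cvg_dominated uM cM.
have [cu' _] := series_cvg_dominated u'M cM.
set F' := limn (series u').
have S0 : 0 <= limn (series M).
  have [_] := series_cvg_dominated uM cM; exact: le_trans (cnorm_ge0 _).
set S := limn (series M) in S0.
have key h : cnorm h < d ->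
    cnorm (series_sum u (z + h) - series_sum u z - h * F') <= cnorm h ^+ 2 * S.
  move=> hd; pose v n := u (z + h) n - u z n - h * u' n.
  have cM2 : cvgn (series (fun n => cnorm h ^+ 2 * M n)).
    by rewrite (_ : (fun _ => _) = cnorm h ^+ 2 *: M)//; apply: is_cvg_seriesZ.
  have [cv nv] := series_cvg_dominated (tM h hd) cM2.
  have vE : series (u (z + h)) = series v + (fun=> h) * series u' + series (u z).
    apply/funext => n; rewrite !fctE /series /= mulr_sumr -!big_split /=.
    by apply: eq_bigr => i _; rewrite /v; ring.
  have cF : series (u (z + h)) @ \oo --> limn (series v) + h * F' + limn (series (u z)).
    rewrite vE; apply: cvgD; last exact: cu.
    apply: cvgD; first exact: cv.
    by apply: cvgM; [exact: cvg_cst|exact: cu'].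
  have -> : series_sum u (z + h) = limn (series v) + h * F' + limn (series (u z)).
    exact: (cvg_lim (@norm_hausdorff _ _) cF).
  have -> : limn (series v) + h * F' + limn (series (u z)) - series_sum u z - h * F'
      = limn (series v) by rewrite /series_sum addrK addrK.
  apply: le_trans nv _; rewrite (_ : (fun _ => _) = cnorm h ^+ 2 *: M)// lim_seriesZ //.
apply/cvg_ex; exists F'; apply/cvg_cnormP => e e0.
have d'0 : 0 < of_real d :> C by rewrite ltcR.
have e'0 : 0 < of_real (e / (S + 1)) :> C by rewrite ltcR divr_gt0 // ltr_wpDl.
near=> h.
have h0 : h != 0 by near: h; exact: nbhs_dnbhs_neq.
have hd : cnorm h < d by rewrite -cnorm_lt; near: h; exact: dnbhs0_lt.
have he : cnorm h < e / (S + 1) by rewrite -cnorm_lt; near: h; exact: dnbhs0_lt.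
have nh := cnorm_gt0 h0.
have -> : F' - h^-1 *: ((series_sum u \o shift z) (h *: 1) - series_sum u z) =
    - (h^-1 * (series_sum u (z + h) - series_sum u z - h * F')).
  rewrite /= /GRing.scale /= mulr1 [h + z]addrC; field; exact: h0.
rewrite cnormN cnormM cnormV ltr_pdivrMl //; apply: le_lt_trans (key h hd) _.
rewrite expr2 -mulrA ltr_pM2l //; apply: (@le_lt_trans _ _ (cnorm h * (S + 1))).
  by rewrite ler_wpM2l ?lerDl // ltW.
by rewrite -ltr_pdivlMr // ltr_wpDl.
Unshelve. all: by end_near. Qed.

End ComplexPower.

(** * The zeta series and its abscissa of convergence *)

Section Zeta.
Variables (R : realType) (B : bratteli) (alpha : R) (a : bpath B -> R) (c C : R).
Hypotheses (alpha0 : 0 < alpha) (alpha1 : alpha < 1) (c0 : 0 < c) (C0 : 0 < C).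
Hypotheses (ca : forall g, c <= a g) (aC : forall g, a g <= C).
Variable s0 : R.
Hypothesis s00 : 0 < s0.
Hypothesis growth_lb : forall n, 1 <= #|fin_path B n.+1|%:R * (alpha `^ s0) ^+ n.
Hypothesis growth_ub : forall s, s0 < s ->
  exists K, forall n, #|fin_path B n|%:R * (alpha `^ s) ^+ n <= K.

Local Notation wt g := (weight alpha a (Tagged (@fin_path B) g)).
Let D := `|ln c| + `|ln C|.
Let a0 g : 0 < a g. Proof. exact: lt_le_trans (ca g). Qed.
Let lna0 : ln alpha < 0. Proof. by rewrite ln_lt0 // alpha0. Qed.

Let powE s n : (alpha `^ s) ^+ n = expR (s * n%:R * ln alpha).
Proof. by rewrite /powR gt_eqF // -expRM_natr; congr expR; ring. Qed.

Lemma ln_weight n (g : fin_path B n) :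
  `|ln (wt g) - n%:R * ln alpha| <= `|ln c| + `|ln C|.
Proof.
rewrite /weight /= lnM ?posrE ?exprn_gt0 // lnXn // mulr_natl addrK.
have h1 : ln c <= ln (a (Tagged (@fin_path B) g)) by rewrite ler_ln ?posrE.
have h2 : ln (a (Tagged (@fin_path B) g)) <= ln C by rewrite ler_ln ?posrE.
have := ler_norm (ln C); have := ler_norm (- ln c); rewrite normrN.
have := normr_ge0 (ln C); have := normr_ge0 (ln c).
by rewrite ler_norml; lra.
Qed.

(** The extra [d] in the exponent leaves room for the powers of the logarithm in the derivative and
    in the remainder. *)
Lemma weight_sum_geometric x : s0 < x -> exists d K t : R,
  [/\ 0 < d, 0 < t < 1 & forall n,
      \sum_(g : fin_path B n) expR (x * ln (wt g) + d * `|ln (wt g)|) <= K * t ^+ n].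
Proof.
(* By this choice [x - d = (s0 + d) + 2 * d]: the part [s0 + d] absorbs the number of paths, and
   [2 * d] yields the geometric ratio. *)
move=> s0x; pose d := (x - s0) / 4; have d0 : 0 < d by rewrite divr_gt0 // subr_gt0.
have [K KP] : exists K, forall n, #|fin_path B n|%:R * (alpha `^ (s0 + d)) ^+ n <= K.
  by apply: growth_ub; rewrite ltrDl.
exists d, (expR ((x + d) * D) * K), (expR (2 * d * ln alpha)); split=> //.
  by rewrite expR_gt0 -[ltRHS]expR0 ltr_expR pmulr_rlt0 // mulr_gt0.
move=> n; apply: (@le_trans _ _ (\sum_(g : fin_path B n)
    expR ((x + d) * D + (x - d) * n%:R * ln alpha))).
  apply: ler_sum => g _; rewrite ler_expR.
  have := ln_weight g; rewrite -/D; move: (ln (wt g)) => L.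
  set y := n%:R * ln alpha => Ly.
  have y0 : y <= 0 by rewrite mulr_ge0_le0 // ltW.
  have x0 : 0 < x by exact: lt_trans s0x.
  have Ln : `|L| <= D - y.
    rewrite -[L](subrK y) (le_trans (ler_normD _ _)) // (ler0_norm y0) lerD //.
  have Lu : L <= D + y by have := le_trans (ler_norm _) Ly; lra.
  have h1 : x * L <= x * (D + y) by rewrite ler_pM2l.
  have h2 : d * `|L| <= d * (D - y) by rewrite ler_pM2l.
  rewrite -mulrA -/y; lra.
rewrite sumr_const -expRM_natr expRD -[X in X <= _]mulr_natl.
have -> : expR ((x - d) * n%:R * ln alpha) =
    (alpha `^ (s0 + d)) ^+ n * expR (2 * d * ln alpha * n%:R).
  by rewrite powE -expRD; congr expR; rewrite /d; field.
rewrite [X in X <= _](_ : _ = expR ((x + d) * D) *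
  (#|fin_path B n|%:R * (alpha `^ (s0 + d)) ^+ n) * expR (2 * d * ln alpha * n%:R));
  last by ring.
by rewrite ler_wpM2r ?expR_ge0 // ler_wpM2l ?expR_ge0.
Qed.

Lemma zeta_dominated z : s0 < re z -> exists u' M d,
  [/\ 0 < d, cvgn (series M), forall n, cnorm (zeta_term alpha a z n) <= M n,
      forall n, cnorm (u' n) <= M n
    & forall h, cnorm h < d -> forall n,
        cnorm (zeta_term alpha a (z + h) n - zeta_term alpha a z n - h * u' n) <=
          cnorm h ^+ 2 * M n].
Proof.
set x := re z => /weight_sum_geometric[d [K [t [d0 /andP[t0 t1] Kt]]]].
(* With [L = ln (wt g)], the summands of [A] pay for the term itself, for a factor [L] in the
   derivative, and for [4 * L ^+ 2] in the remainder. *)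
pose A := 1 + d^-1 + 32 / d ^+ 2.
have d20 : 0 < d ^+ 2 by rewrite exprn_gt0.
have A0 : 0 <= d^-1 /\ 0 <= 32 / d ^+ 2 by rewrite invr_ge0 divr_ge0 ?(ltW d0) ?(ltW d20).
exists (fun n => \sum_(g : fin_path B n) of_real (ln (wt g)) * cpow (wt g) z).
exists (fun n => A * K * t ^+ n), (d / 2).
have sumle n (F : fin_path B n -> R) :
    (forall g, F g <= A * expR (x * ln (wt g) + d * `|ln (wt g)|)) ->
  \sum_g F g <= A * K * t ^+ n.
  move=> FA; apply: (@le_trans _ _
     (A * \sum_(g : fin_path B n) expR (x * ln (wt g) + d * `|ln (wt g)|))).
    by rewrite mulr_sumr; apply: ler_sum => g _; exact: FA.
  by rewrite -mulrA ler_wpM2l // /A; lra.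
split.
- by rewrite divr_gt0.
- by apply: is_cvg_geometric_series; rewrite ger0_norm // ltW.
- move=> n; apply: le_trans (cnorm_sum _ _ _) _; apply: sumle => g.
  rewrite cnorm_cpow -/x expRD mulrCA ler_peMr ?expR_ge0 //.
  have : 1 <= expR (d * `|ln (wt g)|) by rewrite -[leLHS]expR0 ler_expR mulr_ge0 // ltW.
  rewrite /A; nra.
- move=> n; apply: le_trans (cnorm_sum _ _ _) _; apply: sumle => g.
  rewrite cnormM cnorm_cpow -/x expRD mulrC mulrCA ler_wpM2l ?expR_ge0 //.
  have -> : cnorm (of_real (ln (wt g))) = `|ln (wt g)|.
    by rewrite /cnorm /of_real /= expr0n addr0 sqrtr_sqr.
  have := expR_ge1Dx (d * `|ln (wt g)|); move: (`|_|) (normr_ge0 (ln (wt g))) => L L0 he.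
  apply: (@le_trans _ _ (d^-1 * expR (d * L))).
    by rewrite ler_pdivlMl //; lra.
  by rewrite ler_wpM2r ?expR_ge0 // /A; lra.
move=> h hd n; rewrite /zeta_term mulr_sumr -!sumrB.
apply: le_trans (cnorm_sum _ _ _) _.
have [->|h0] := eqVneq h 0.
  rewrite cnorm0 expr2 !mul0r big1 // => g _.
  by rewrite (addr0 z) subrr mul0r subr0 cnorm0.
have nh := cnorm_gt0 h0; have nh2 : 0 < cnorm h ^+ 2 by rewrite exprn_gt0.
rewrite -ler_pdivrMl // mulr_sumr; apply: sumle => g.
set w := wt g; set L := ln w.
have -> : cpow w (z + h) - cpow w z - h * (of_real L * cpow w z) =
    cpow w z * (cpow w h - 1 - h * of_real L) by rewrite cpowD; ring.
rewrite cnormM cnorm_cpow -/x -/L ler_pdivrMl //.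
apply: (@le_trans _ _ (expR (x * L) * (4 * (cnorm h * L) ^+ 2 * expR (cnorm h * `|L|)))).
  by rewrite ler_wpM2l ?expR_ge0 // cpow_taylor.
rewrite [leLHS](_ : _ =
  cnorm h ^+ 2 * (expR (x * L) * (4 * L ^+ 2 * expR (cnorm h * `|L|)))); last by ring.
rewrite ler_wpM2l ?(ltW nh2) // expRD [leRHS]mulrCA ler_wpM2l ?expR_ge0 //.
(* Half of [d] absorbs [expR (cnorm h * |L|)], the other half absorbs [4 * L ^+ 2] through the
   quadratic term of the exponential series. *)
have hL : expR (cnorm h * `|L|) <= expR (d / 2 * `|L|) by rewrite ler_expR ler_wpM2r // ltW.
have -> : expR (d * `|L|) = expR (d / 2 * `|L|) * expR (d / 2 * `|L|).
  by rewrite -expRD; congr expR; field.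
rewrite [leRHS]mulrA; apply: ler_pM hL; [|exact: expR_ge0|].
  by rewrite mulr_ge0 // sqr_ge0.
have y0 : 0 <= d / 2 * `|L| by rewrite mulr_ge0 // divr_ge0 // ltW.
have := expR_ge1Dxn 1 y0; set E := expR _ => hE.
apply: (@le_trans _ _ (32 / d ^+ 2 * E)); last first.
  by rewrite ler_wpM2r ?expR_ge0 // /A; lra.
rewrite mulrAC ler_pdivlMr //; move: hE.
have -> : (d / 2 * `|L|) ^+ 2 / 2`!%:R = d ^+ 2 * L ^+ 2 / 8.
  by rewrite (_ : 2`!%:R = 2) // !exprMn real_normK ?num_real //; field.
lra.
Qed.

Lemma zeta_cvg z : s0 < re z -> cvgn (series (zeta_term alpha a z)).
Proof.
move=> /zeta_dominated[u' [M [d [_ cM zM _ _]]]].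
exact: (series_cvg_dominated zM cM).1.
Qed.

Lemma zeta_holomorphic :
  holomorphic_on [set z | s0 < re z] (series_sum (zeta_term alpha a)).
Proof.
move=> z /= /zeta_dominated[u' [M [d [d0 cM zM u'M tM]]]].
exact: (derivable_series_sum d0 cM zM u'M tM).
Qed.

(** The terms of index 1 to [N] are bounded below one by one: [s0 * ln alpha] comes from the shift
    of the length, [(s0 + 1) * D] from comparing weights with powers of [alpha], and the last 1 from
    [t]. *)
Lemma zeta_partial_ge (t : R) N : 0 <= t <= 1 -> t * (N.+1)%:R * - ln alpha <= 1 ->
  N%:R * expR (s0 * ln alpha - (s0 + 1) * D - 1) <=
    \sum_(0 <= n < N.+1) re (zeta_term alpha a (of_real (s0 + t)) n).
Proof.
move=> /andP[t0 t1] tN.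
have reE n : re (zeta_term alpha a (of_real (s0 + t)) n) =
    \sum_(g : fin_path B n) expR ((s0 + t) * ln (wt g)).
  by rewrite /zeta_term re_sum; apply: eq_bigr => g _; rewrite cpow_of_real.
rewrite big_nat_recl // -[leLHS]add0r lerD //.
  by rewrite reE sumr_ge0 // => g _; exact: expR_ge0.
rewrite mulr_natl -[X in _ *+ X]subn0 -sumr_const_nat.
rewrite !big_nat; apply: ler_sum => n /andP[_ nN]; rewrite reE.
apply: (@le_trans _ _ (\sum_(g : fin_path B n.+1)
   expR ((s0 * n%:R) * ln alpha + (s0 * ln alpha - (s0 + 1) * D - 1)))).
  rewrite sumr_const -[leRHS]mulr_natl (expRD (s0 * n%:R * ln alpha)) -powE mulrA.
  by rewrite ler_peMl ?expR_ge0.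
apply: ler_sum => g _; rewrite ler_expR.
have := ln_weight g; rewrite -/D ler_norml => /andP[+ _].
have D0 : 0 <= D by rewrite addr_ge0.
move: (ln (wt g)) => L; rewrite -natr1 => hL.
have h1 : (s0 + t) * (- D + (n%:R + 1) * ln alpha) <= (s0 + t) * L.
  by rewrite ler_wpM2l ?addr_ge0 ?(ltW s00) //; lra.
have h2 : t * (n%:R + 1) * - ln alpha <= 1.
  apply: le_trans tN; rewrite ler_wpM2r ?oppr_ge0 ?(ltW lna0) // ler_wpM2l //.
  by rewrite natr1 ler_nat ltnW.
have h3 : t * D <= 1 * D by rewrite ler_wpM2r.
apply: le_trans h1; lra.
Qed.

Lemma zeta_singular : singular_at s0 (series_sum (zeta_term alpha a)).
Proof.
move=> [U [g [Uop Us gh gE]]].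
have cg : {for (of_real s0 : @cplx R), continuous g}.
  exact/differentiable_continuous/derivable1_diffP/gh.
have /nbhs_normP[_ /= /gt0_of_real[r r0 ->] rP] :
    \forall y \near (of_real s0 : @cplx R), U y /\ cnorm (g (of_real s0) - g y) < 1.
  apply: filterI; first exact: open_nbhs_nbhs.
  by move/cvg_cnormP : cg; apply; exact: ltr01.
(* Near [s0] the real part of [g] is at most [b], while [N] terms of size [k] exceed [b]; [t] is
   small enough both for the neighbourhood and for [zeta_partial_ge]. *)
pose k := expR (s0 * ln alpha - (s0 + 1) * D - 1).
pose b := cnorm (g (of_real s0)) + 1.
have k0 : 0 < k := expR_gt0 _.
have b0 : 0 <= b by rewrite addr_ge0 // cnorm_ge0.
pose N := Num.bound (b / k).
have bN : b < N%:R * k by rewrite -ltr_pdivrMr // archi_boundP // divr_ge0 // ltW.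
have nl0 : 0 < N.+1%:R * - ln alpha by rewrite mulr_gt0 ?oppr_gt0.
pose t := Num.min (r / 2) (Num.min 1 (N.+1%:R * - ln alpha)^-1).
have t0 : 0 < t by rewrite /t !lt_min divr_gt0 // ltr01 invr_gt0.
have tr : t < r.
  by apply: (@le_lt_trans _ _ (r / 2)); [rewrite ge_min lexx|rewrite ltr_pdivrMr //; lra].
have t1 : t <= 1 by rewrite /t !ge_min lexx orbT.
have tN : t * N.+1%:R * - ln alpha <= 1.
  by rewrite -mulrA -ler_pdivlMr // mul1r /t !ge_min lexx !orbT.
have s0t : s0 < re (of_real (s0 + t) : @cplx R) by rewrite /re /= ltrDl.
have [Ut gt] : U (of_real (s0 + t)) /\ cnorm (g (of_real s0) - g (of_real (s0 + t))) < 1.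
  apply: rP; rewrite /= cnorm_lt.
  have -> : of_real s0 - of_real (s0 + t) = of_real (- t) :> @cplx R.
    by apply/eqP; rewrite eq_complex /=; apply/andP; split; apply/eqP; ring.
  by rewrite /cnorm /of_real /= expr0n addr0 sqrtr_sqr normrN ger0_norm // ltW.
have gb : re (g (of_real (s0 + t))) <= b.
  rewrite (le_trans (ler_norm _)) // (le_trans (re_le_cnorm _)) //.
  rewrite -[g _](subKr (g (of_real s0))) (le_trans (cnormD _ _)) // cnormN lerD // ltW //.
move: gb; rewrite gE // leNgt => /negP; apply; apply: lt_le_trans bN _.
have := zeta_cvg s0t => /cvg_re cre.
rewrite /series_sum -(cvg_lim _ cre) //.
apply: le_trans (zeta_partial_ge _ tN) _; first by rewrite (ltW t0).
rewrite -re_sum.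
have term_ge0 n : 0 <= re (zeta_term alpha a (of_real (s0 + t)) n).
  rewrite /zeta_term re_sum sumr_ge0 // => h _.
  by rewrite cpow_of_real /re /= expR_ge0.
apply: (@nondecreasing_cvgn_le _
  (fun n => re (series (zeta_term alpha a (of_real (s0 + t))) n))).
  move=> m n mn; rewrite -subr_ge0 -reN -reD sub_series_geq // re_sum.
  by rewrite sumr_ge0.
by apply/cvg_ex; eexists; exact: cre.
Qed.

(** Of two distinct abscissas, the smaller one makes the sum holomorphic around the larger one,
    against the singularity there. *)
Lemma zeta_abscissa : unique (is_abscissa (zeta_term alpha a)) s0.
Proof.
have opn (x : R) : open [set z : @cplx R | x < re z].
  rewrite openE => z /= xz; apply/nbhs_normP.
  exists (of_real (re z - x)) => /=; first by rewrite ltcR subr_gt0.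
  move=> y /=; rewrite cnorm_lt => zy; have := le_lt_trans (re_le_cnorm (z - y)) zy.
  by rewrite reD reN ltr_norml; lra.
split=> [|s [_ _ hols sings]].
  split=> //; [exact: zeta_cvg|exact: zeta_holomorphic|exact: zeta_singular].
apply: le_anti; apply/andP; split; rewrite leNgt; apply/negP => lts.
  apply: zeta_singular; exists [set z | s < re z], (series_sum (zeta_term alpha a)).
  by [].
apply: sings; exists [set z | s0 < re z], (series_sum (zeta_term alpha a)).
by split=> //; exact: zeta_holomorphic.
Qed.

End Zeta.

(** * The critical exponent and its equality with the dimension *)

Lemma fin_path_growth (R : realType) (B : bratteli) (alpha : R) :
    0 < alpha < 1 -> cantor_set (inf_path B) ->
  exists s0 : R, [/\ 0 < s0,
    forall n, 1 <= #|fin_path B n.+1|%:R * (alpha `^ s0) ^+ n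
  & forall s, s0 < s -> exists K, forall n, #|fin_path B n|%:R * (alpha `^ s) ^+ n <= K].
Proof.
move=> /andP[al0 al1] [[x0 _] _ _ iso0].
have b0 : 0 < - ln alpha by rewrite oppr_gt0 ln_lt0 // al0.
have wexp : exists2 k, (0 < k)%N & forall j, (2 ^ j <= nb_walks B (j * k))%N.
  apply: nb_walks_exp.
    exists (path_start x0); apply/asboolP; exists (path_edges x0).
    exact: path_infinite_walk.
  move=> v f /infinite_walk_path[x <- <-].
  have [y yx xy] := no_isolated_path x iso0.
  exists (path_edges y); first by rewrite -yx; exact: path_infinite_walk.
  move=> fxy; apply: xy; apply: inf_path_ext => -[|j]; first exact/esym/yx.
  exact: (congr1 (fun f => f j) fxy).
have [s0 [s00 lb ub]] := growth_exponent b0 (@nb_walksD B) wexp.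
have powE s n : (alpha `^ s) ^+ n = expR (- (s * - ln alpha * n%:R)).
  by rewrite /powR gt_eqF // -expRM_natr; congr expR; ring.
have e0 := path_edges x0 0.
exists s0; split=> // [n|s s0s]; first by rewrite card_fin_path // powE.
(* The empty path has no counterpart among the walks, so its count is added to the constant. *)
have [K KP] := ub s s0s; exists (#|fin_path B 0|%:R + K) => n.
have K0 : 0 <= K by apply: le_trans (KP 0%N); rewrite mulr_ge0 ?expR_ge0.
have as1 : alpha `^ s <= 1.
  by rewrite -(powRr0 alpha) ger_powR ?al0 ?(ltW al1) // ltW // (lt_trans s00).
case: n => [|n]; first by rewrite expr0 mulr1 lerDl.
rewrite card_fin_path // exprSr mulrA -[leLHS]add0r lerD //.
by apply: le_trans (KP n); rewrite -powE ler_piMr // mulr_ge0 // exprn_ge0 // powR_ge0.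
Qed.

Theorem theorem2p12 (R : realType) (B : bratteli) (alpha : R)
    (a : bpath B -> R) (rho : inf_path B -> inf_path B -> R) :
  cantor_set (inf_path B) ->
  self_similar_ultrametric alpha a rho ->
  exists s0 : R,
    unique (is_abscissa (zeta_term alpha a)) s0 /\
    hausdorff_dimension rho [set: inf_path B] = s0%:E.
Proof.
move=> cantor [al01 [_ ainf asup] _ _ [rho_id rho_w]].
have [s0 [s00 lb ub]] := fin_path_growth al01 cantor.
have [[x0 _] _ _ _] := cantor; have /andP[al0 al1] := al01.
have [c c0 ca] := ereal_inf_gt0_lb ainf; have [C aC] := ereal_sup_lty_ub asup.
have C0 : 0 < C by rewrite (lt_le_trans c0) // (le_trans (ca (truncation x0 0))).
exists s0; split; first exact: (zeta_abscissa al0 al1 c0 C0 ca aC s00 lb ub).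
apply/eqP; rewrite eq_le; apply/andP; split.
  (* The measure vanishes at [s0 + e] because the count is bounded at the intermediate exponent
     [s0 + e / 2]. *)
  apply/lee_addgt0Pr => e e0; apply: ereal_inf_lbound; exists (s0 + e) => //.
  split; first by rewrite addr_ge0 // ltW.
  have [|K KP] := ub (s0 + e / 2); first by rewrite ltrDl divr_gt0.
  apply: (dimension_ub al0 al1 c0 ca rho_w C0 aC rho_id _ _ KP).
    by rewrite addr_gt0 // divr_gt0.
  by rewrite ltrD2l ltr_pdivrMr //; lra.
apply: le_ereal_inf_tmp => _ [s [/= sge0 Hs] <-]; rewrite lee_fin leNgt.
(* A count bounded at some [s < s0] would, at the exponent [s0], tend to 0 in contradiction to
   [lb]. *)
apply/negP => ss0; have [K KP] := dimension_lb al0 al1 c0 ca rho_w x0 sge0 Hs.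
have al1' : `|alpha `^ (s0 - s)| < 1.
  rewrite ger0_norm ?powR_ge0 // /powR gt_eqF // -[ltRHS]expR0 ltr_expR.
  by rewrite pmulr_rlt0 ?subr_gt0 // ln_lt0.
have K0 : 0 < K + 1.
  by rewrite ltr_wpDl // (le_trans _ (KP 0%N)) // mulr_ge0 // exprn_ge0 // powR_ge0.
have Ki0 : 0 < (K + 1)^-1 by rewrite invr_gt0.
have /cvgr0Pnorm_lt/(_ _ Ki0)[n _ /(_ n (leqnn n))/=] := cvg_expr al1'.
rewrite ger0_norm ?exprn_ge0 ?powR_ge0 // => nK.
have := lb n; rewrite (card_fin_path (path_edges x0 0)) leNgt => /negP; apply.
have -> : (alpha `^ s0) ^+ n = (alpha `^ s) ^+ n * (alpha `^ (s0 - s)) ^+ n.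
  by rewrite -exprMn -powRD ?subrKC // gt_eqF ?implybT.
rewrite mulrA; apply: (@le_lt_trans _ _ (K * (alpha `^ (s0 - s)) ^+ n)).
  by rewrite ler_wpM2r ?exprn_ge0 ?powR_ge0.
apply: (@le_lt_trans _ _ ((K + 1) * (alpha `^ (s0 - s)) ^+ n)).
  by rewrite ler_wpM2r ?exprn_ge0 ?powR_ge0 // lerDl.
by rewrite -ltr_pdivlMl // mulr1.
Qed.
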